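(* Let $k\ge3$ be an integer. For a random plane recursive tree of size $n$, let $Z_n$ be its $k$-th order generalized Zagreb index and $R_n$ the degree of its root. Then for all integers $r,s\ge0$, $$\mathbb{E}(Z_n^rR_n^s)\sim g_{r,s}\,n^{(kr+s)/2},\qquad n\to\infty,$$ where $g_{0,s}=s!\sqrt\pi/\Gamma((s+1)/2)$ for $s\ge0$ and, for $r\ge1$, $g_{r,s}$ satisfies the following recurrences: for $s>0$ $$g_{r,s}=\frac{1}{2\sqrt{\pi}\,\Gamma\left(\frac{kr+s+1}{2}\right)}\sum_{\ell=1}^{r}\binom{r}{\ell}g_{\ell,0}\,g_{r-\ell,s}\,\Gamma\left(\frac{k\ell-1}{2}\right)\Gamma\left(\frac{k(r-\ell)+s+1}{2}\right)+\frac{\Gamma\left(\frac{kr+s}{2}\right)}{\Gamma\left(\frac{kr+s+1}{2}\right)}\bigl(kr\,g_{r-1,k+s-1}+s\,g_{r,s-1}\bigr),$$ and for $s=0$ $$g_{r,0}=\frac{1}{\sqrt{\pi}\,(kr-2)\,\Gamma\left(\frac{kr-1}{2}\right)}\sum_{\ell=1}^{r-1}\binom{r}{\ell}g_{\ell,0}\,g_{r-\ell,0}\,\Gamma\left(\frac{k\ell-1}{2}\right)\Gamma\left(\frac{k(r-\ell)+1}{2}\right)+\frac{kr\,\Gamma\left(\frac{kr}{2}-1\right)}{\Gamma\left(\frac{kr-1}{2}\right)}\,g_{r-1,k-1}.$$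
   Context: A random plane recursive tree of size $n$ is built as follows: start with a root labeled $1$. A node with $m$ children has $m+1$ free places (before the first child, between consecutive children, after the last child). In step $i$ ($2\le i\le n$) the node labeled $i$ is attached at a free place chosen uniformly at random among all free places of all existing nodes. The children of each node are ordered from left to right. For a graph $G=(V,E)$, the $k$-th order generalized Zagreb index is $\sum_{v\in V}D_v^k$, where $D_v$ is the (graph) degree of $v$. *)

(* Defs.v *)
From HB Require Import structures.
From mathcomp Require Export all_boot all_order all_algebra.
From mathcomp Require Export all_classical all_reals all_analysis.

Set Implicit Arguments.
Unset Strict Implicit.
Unset Printing Implicit Defensive.

Export Order.TTheory GRing.Theory Num.Theory.
Export numFieldNormedType.Exports.

Local Open Scope classical_set_scope.
Local Open Scope ring_scope.

(* A plane (rooted, ordered) tree on labelled nodes is given by the sequence of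
   its lists of children, each list ordered from left to right.  Indices start
   at 0: the node labelled i is index i - 1, and the root is index 0. *)
Definition plane_tree := seq (seq nat).

Definition children (t : plane_tree) (v : nat) : seq nat := nth [::] t v.

Definition root_tree : plane_tree := [:: [::]].

(* (v, j) is the place of node v that has exactly j children of v to its left;
   a node with m children has the m + 1 places j = 0, ..., m. *)
Definition free_places (t : plane_tree) : seq (nat * nat) :=
  [seq (v, j) | v <- iota 0 (size t), j <- iota 0 (size (children t v)).+1].

(* The new node gets the first unused index, size t, and is a leaf. *)
Definition attach (t : plane_tree) (p : nat * nat) : plane_tree :=
  let c := children t p.1 in
  rcons (set_nth [::] t p.1 (take p.2 c ++ size t :: drop p.2 c)) [::].

Definition adjacent (t : plane_tree) : rel nat :=
  [rel u v | (v \in children t u) || (u \in children t v)].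

Definition degree (t : plane_tree) (v : nat) : nat :=
  #|[set u : 'I_(size t) | adjacent t v u]%SET|.

Definition zagreb (k : nat) (t : plane_tree) : nat :=
  (\sum_(v < size t) degree t v ^ k)%N.

Definition root_degree (t : plane_tree) : nat := degree t 0.

(* T i is the tree after step i and U i is the place used in step i.
   A labelled tree determines the order in which its nodes were attached, so
   conditioning on T i is the same as conditioning on the first i steps. *)
Definition random_plane_recursive_tree (R : realType) (d : measure_display)
    (Omega : measurableType d) (P : probability Omega R) (n : nat)
    (X : Omega -> plane_tree) : Prop :=
  exists (T : nat -> Omega -> plane_tree) (U : nat -> Omega -> nat * nat),
  [/\ forall w, T 1%N w = root_tree,
      forall i, (1 <= i < n)%N -> forall w,
        T i.+1 w = attach (T i w) (U i.+1 w),
      forall i, (1 <= i < n)%N -> forall (t : plane_tree) (p : nat * nat),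
        measurable [set w | T i w = t /\ U i.+1 w = p] /\
        P [set w | T i w = t /\ U i.+1 w = p] =
          (P [set w | T i w = t] *
           (if p \in free_places t then (size (free_places t))%:R^-1
            else 0)%:E)%E &
      X = T n].

Definition Gamma (R : realType) (x : R) : R :=
  \int[@lebesgue_measure R]_(t in `]0, +oo[) (t `^ (x - 1) * expR (- t)).

(* Main.v *)
From HB Require Import structures.
Require Import Defs.
From mathcomp Require Import measurable_realfun ring zify.
Set Implicit Arguments.
Unset Strict Implicit.
Unset Printing Implicit Defensive.
Local Open Scope classical_set_scope.
Local Open Scope ring_scope.

(** Why the theorem holds.

    Only the numbers of children matter.  List them, the root first: a node
    with m children has m + 1 places, so one step picks an entry m with weight
    m + 1, replaces it by m + 1 and appends a 0.  The index and the degree of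
    the root are functions of this list, because the degree of a node is its
    number of children, plus one unless it is the root.

    A step acts on a single entry, hence on a product of functions of the
    entries by the Leibniz rule.  So the total weight of such a product over
    all n-step histories has as exponential generating function a product of
    one factor per initial node ([iter_grow_weight]), and the factors solve a
    linear system of differential equations.  Uniqueness for that system gives
    the decomposition of a tree into the leftmost subtree of its root and the
    rest, which are again plane recursive trees on complementary sets of labels
    ([nodegf_leftmost]).  With the weight x^Z, where Z is the index, and with
    (x d/dx)^r evaluated at x = 1, it becomes a recursion for the moments
    ([wsum_leftmost]): for r + s > 0, the weighted moments p_(r,s) of Z^r R^s satisfy
      p_(r,s) = sum_l C(r,l) q_l * p'_(r-l,s),
    where * is the Cauchy product, a prime means that the root has received one
    more edge, and q_l belongs to the leftmost subtree.

    The generating function of q_0 is 1 - (1-z)^(1/2), so multiplication by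
    (1-z)^(-1/2) removes the term l = 0 ([pmom_solve]).  If s = 0, the term
    l = r still contains p_(r,0) itself, inside a discrete Volterra equation;
    solving it ([asymp_volterra]) produces the factor kr - 2.

    Asymptotics are measured against [invpow a n], the coefficient of z^n in
    (1-z)^(-a/2).  The Cauchy product of two such sequences is another one, so
    sequences asymptotic to a multiple of [invpow a] are stable under Cauchy
    products ([asymp_conv]).  Induction on r, and then on s, shows that
    p_(r,s) is asymptotic to A_(r,s) invpow (kr+s+1), with a recursion for
    A_(r,s) in which no Gamma occurs ([momcst_pos], [momcst_zero]).  In it
    kr A_(r-1,k+s-1) and s A_(r,s-1) are all that remains, to leading order, of
    the difference between primed and unprimed moments ([asymp_excessmom]).

    Gamma enters through the ratio of invpow a n to invpow 1 n, asymptotically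
    sqrt(pi) n^((a-1)/2) / Gamma(a/2) ([invpow_growth]): the substitution t = x^2
    turns Gamma(a/2) into a Gaussian moment, integration by parts gives the
    functional equation, and log-convexity controls the ratio of consecutive
    values.

    Finally, the random tree is the endpoint of a uniform random history
    ([tree_integral]), so that its moments are p_(r,s) / p_(0,0). *)

(** * Cauchy products *)

Section Cauchy.
Variable K : comNzRingType.
Implicit Types x y z : nat -> K.

Definition conv x y (n : nat) : K := \sum_(i < n.+1) x i * y (n - i)%N.

(** Transfers the ring laws of polynomials to Cauchy products. *)
Lemma conv_coef x y (N n : nat) : (n < N)%N ->
  conv x y n = ((\poly_(i < N) x i) * (\poly_(i < N) y i))`_n.
Proof.
move=> nN; rewrite coefM /conv; apply: eq_bigr => i _.
rewrite !coef_poly (leq_trans (ltn_ord i) nN).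
by rewrite (leq_ltn_trans (leq_subr _ _) nN).
Qed.

Lemma convC x y : conv x y = conv y x.
Proof. by apply/funext => n; rewrite !(@conv_coef _ _ n.+1)// mulrC. Qed.

Lemma convA x y z : conv x (conv y z) = conv (conv x y) z.
Proof.
apply/funext => n; pose N := n.+1.
transitivity ((\poly_(i < N) x i * (\poly_(i < N) y i * \poly_(i < N) z i))`_n).
  rewrite coefM; apply: eq_bigr => i _.
  rewrite coef_poly (ltn_ord i) (@conv_coef _ _ N)//.
  by rewrite ltnS leq_subr.
rewrite mulrA coefM; apply: eq_bigr => i _.
by rewrite coef_poly ltnS leq_subr (@conv_coef _ _ N).
Qed.

Lemma convCA x y z : conv x (conv y z) = conv y (conv x z).
Proof. by rewrite convA (convC x) -convA. Qed.

Lemma convDl x y z : conv (x \+ y) z = conv x z \+ conv y z.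
Proof.
apply/funext => n; rewrite /conv/= -big_split/=.
by apply: eq_bigr => i _; rewrite mulrDl.
Qed.

Lemma convDr x y z : conv x (y \+ z) = conv x y \+ conv x z.
Proof. by rewrite convC convDl !(convC x). Qed.

Lemma convZl (c : K) x y : conv (fun n => c * x n) y = fun n => c * conv x y n.
Proof.
apply/funext => n; rewrite /conv big_distrr/=.
by apply: eq_bigr => i _; rewrite mulrA.
Qed.

Lemma convZr (c : K) x y : conv x (fun n => c * y n) = fun n => c * conv x y n.
Proof. by rewrite convC convZl convC. Qed.

Lemma convMnr k x y : conv x (fun n => y n *+ k) = fun n => conv x y n *+ k.
Proof.
apply/funext => n; rewrite /conv -sumrMnl.
by apply: eq_bigr => i _; rewrite mulrnAr.
Qed.

Lemma conv_sumr (I : Type) (r : seq I) (P : pred I) x (y : I -> nat -> K) :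
  conv x (fun n => \sum_(i <- r | P i) y i n) =
  fun n => \sum_(i <- r | P i) conv x (y i) n.
Proof.
apply/funext => n; rewrite /conv exchange_big/=.
by apply: eq_bigr => i _; rewrite big_distrr.
Qed.

Definition delta (n : nat) : K := (n == 0)%:R.

Lemma conv_delta x : conv delta x = x.
Proof.
apply/funext => n; rewrite /conv big_ord_recl/= /delta mul1r subn0.
by rewrite big1 ?addr0// => i _; rewrite mul0r.
Qed.

(** If f is the generating function of [x], this is the sequence of 2 f'.  The
    factor 2 absorbs the powers of 2 in the normalization of [wsum]. *)
Definition dseq x (n : nat) : K := (2 * n.+1)%N%:R * x n.+1.

Lemma dseq_conv x y : dseq (conv x y) = conv (dseq x) y \+ conv x (dseq y).
Proof.
apply/funext => n; rewrite /dseq/= /conv.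
pose f i := i%:R * x i * y (n.+1 - i)%N.
pose g i := (n.+1 - i)%:R * x i * y (n.+1 - i)%N.
have -> : (2 * n.+1)%:R * (\sum_(i < n.+2) x i * y (n.+1 - i)%N) =
    2 * (\sum_(i < n.+2) f i) + 2 * (\sum_(i < n.+2) g i).
  rewrite -mulrDr natrM -mulrA; congr (_ * _); rewrite -big_split big_distrr/=.
  apply: eq_bigr => i _; rewrite /f /g -2!mulrA -mulrDl -natrD subnKC//.
  by rewrite -ltnS.
congr (_ + _).
  rewrite big_ord_recl /f !mul0r add0r big_distrr/=.
  by apply: eq_bigr => i _; rewrite /bump/= add1n subSS natrM !mulrA.
rewrite big_ord_recr /g/= subnn !mul0r addr0 big_distrr/=.
apply: eq_bigr => i _; have -> : (n.+1 - i)%N = (n - i).+1.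
  by rewrite subSn// -ltnS.
rewrite (natrM _ 2); ring.
Qed.

End Cauchy.
Arguments delta {K}.

(** * Coefficients of inverse powers of 1 - z *)

Section BinomialSeries.
Variable R : realType.

(** The coefficient of z^n in (1-z)^(-a/2). *)
Definition invpow (a n : nat) : R := \prod_(i < n) ((a%:R / 2 + i%:R) / i.+1%:R).

Lemma invpow0 a : invpow a 0 = 1. Proof. by rewrite /invpow big_ord0. Qed.

Lemma invpowS a n : invpow a n.+1 = invpow a n * ((a%:R / 2 + n%:R) / n.+1%:R).
Proof. by rewrite /invpow big_ord_recr. Qed.

Lemma invpow_gt0 a n : (0 < a)%N -> 0 < invpow a n.
Proof.
move=> a0; apply: prodr_gt0 => i _.
by rewrite divr_gt0// ltr_wpDr// divr_gt0// ltr0n.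
Qed.

Lemma invpow_ge0 a n : (0 < a)%N -> 0 <= invpow a n.
Proof. by move=> ?; exact/ltW/invpow_gt0. Qed.

Lemma invpow_neq0 a n : (0 < a)%N -> invpow a n != 0.
Proof. by move=> ?; exact/lt0r_neq0/invpow_gt0. Qed.

Lemma invpow2 n : invpow 2 n = 1.
Proof.
by elim: n => [|n ih]; rewrite ?invpow0// invpowS ih mul1r divff// -natr1 addrC divff.
Qed.

Lemma dseq_invpow a n : dseq (invpow a) n = (a%:R + 2 * n%:R) * invpow a n.
Proof. by rewrite /dseq invpowS natrM; field; rewrite nat1r pnatr_eq0. Qed.

Lemma invpow_raise2 a n : (0 < a)%N ->
  invpow (a + 2) n = invpow a n * ((a%:R + 2 * n%:R) / a%:R).
Proof.
move=> a0; have a0' : a%:R != 0 :> R by rewrite pnatr_eq0 -lt0n.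
elim: n => [|n ih]; first by rewrite !invpow0 mulr0 addr0 divff ?mulr1.
rewrite !invpowS ih natrD -natr1; field.
by rewrite a0' ?natr1 nat1r pnatr_eq0.
Qed.

(** Both sides satisfy the first order recursion that expresses
    2 (1-z) f' = (a + b) f. *)
Lemma conv_invpow a b : conv (invpow a) (invpow b) = invpow (a + b).
Proof.
apply/funext; elim => [|n ih]; first by rewrite /conv big_ord1 !invpow0 mulr1.
have n0 : (2 * n.+1)%N%:R != 0 :> R by rewrite pnatr_eq0.
apply: (mulfI n0); have := congr1 (@^~ n) (dseq_conv (invpow a) (invpow b)).
rewrite {1}/dseq/= => ->; rewrite -/(dseq (invpow (a + b)) n) dseq_invpow -ih.
rewrite /conv -big_split big_distrr/=; apply: eq_bigr => i _.
have ni : (i <= n)%N by rewrite -ltnS.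
rewrite !dseq_invpow natrD natrB//; ring.
Qed.

End BinomialSeries.

(** * Limits of real sequences *)

Section SequenceLimits.
Variable R : realType.
Implicit Types (x y : nat -> R) (A B : R).

Lemma seq_cvgM x y A B : x n @[n --> \oo] --> A -> y n @[n --> \oo] --> B ->
  x n * y n @[n --> \oo] --> A * B.
Proof. by move=> xA yB; exact: cvgM. Qed.

Lemma seq_cvgD x y A B : x n @[n --> \oo] --> A -> y n @[n --> \oo] --> B ->
  x n + y n @[n --> \oo] --> A + B.
Proof. by move=> xA yB; exact: cvgD. Qed.

Lemma seq_cvgV x A : A != 0 -> x n @[n --> \oo] --> A ->
  (x n)^-1 @[n --> \oo] --> A^-1.
Proof. by move=> A0 xA; exact: cvgV. Qed.

Lemma seq_cvg_eq x y A : (\forall n \near \oo, x n = y n) ->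
  x n @[n --> \oo] --> A -> y n @[n --> \oo] --> A.
Proof. by move=> xy; apply: cvg_trans; apply: near_eq_cvg. Qed.

Lemma seq_cvg_cst A : (fun=> A) n @[n --> \oo] --> A.
Proof. exact: cvg_cst. Qed.

Lemma seq_cvgZ (c : R) x A : x n @[n --> \oo] --> A ->
  c * x n @[n --> \oo] --> c * A.
Proof. by apply: seq_cvgM; exact: seq_cvg_cst. Qed.

Lemma seq_cvgS x A : x n.+1 @[n --> \oo] --> A -> x n @[n --> \oo] --> A.
Proof. by move=> h; rewrite -(cvg_shiftS x). Qed.

Lemma cvg_pow x A m :
  x n @[n --> \oo] --> A -> x n ^+ m @[n --> \oo] --> A ^+ m.
Proof.
by move=> xA; apply: (cvg_comp x (fun t => t ^+ m) xA); exact: exprn_continuous.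
Qed.

End SequenceLimits.

(** * Gamma at half-integers *)

Section GammaHalfIntegers.
Variable R : realType.
Notation mu := (@lebesgue_measure R).

Definition xgauss (m : nat) (x : R) : R := x ^+ m * expR (- x ^+ 2).

Lemma xgauss_continuous m : continuous (xgauss m).
Proof.
move=> x; rewrite /continuous_at/xgauss; apply: cvgM; first exact: exprn_continuous.
apply: (continuous_comp (f := fun y : R => - y ^+ 2) (g := expR)).
  by apply: continuousN; exact: exprn_continuous.
exact: continuous_expR.
Qed.

Lemma xgauss_ge0 m x : 0 <= x -> 0 <= xgauss m x.
Proof. by move=> x0; rewrite mulr_ge0 ?exprn_ge0 ?expR_ge0. Qed.

Lemma is_derive_gauss (x : R) :
  is_derive x 1 (fun y : R => expR (- y ^+ 2)) (- (2 * xgauss 1 x)).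
Proof.
have h1 := is_deriveN (is_deriveX 2 (is_derive_id x 1)).
have h2 := is_derive1_comp (f := expR) (is_derive_expR ((- (id : R -> R) ^+ 2) x)) h1.
apply: (is_derive_eq h2).
rewrite /xgauss !fctE /= /GRing.scale/= expr1; ring.
Qed.

Lemma is_derive_xgaussS m (x : R) :
  is_derive x 1 (xgauss m.+1) (m.+1%:R * xgauss m x - 2 * xgauss m.+2 x).
Proof.
have := is_deriveX m.+1 (is_derive_id x 1); rewrite exprfctE => h1.
apply: (is_derive_eq (is_deriveM h1 (is_derive_gauss x))).
rewrite /xgauss /= /GRing.scale/= expr1 !exprS; ring.
Qed.

Lemma xgauss_decay m x : 1 <= x -> xgauss m x <= m.+1`!%:R / x.
Proof.
move=> x1; have x0 : 0 < x by apply: lt_le_trans x1.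
have f0 : 0 < m.+1`!%:R :> R by rewrite ltr0n fact_gt0.
rewrite /xgauss expRN ler_pdivlMr// mulrAC ler_pdivrMr ?expR_gt0// -exprSr.
rewrite mulrC -ler_pdivrMr//; apply: (@le_trans _ _ (expR x)).
  by apply: le_trans (expR_ge1Dxn m (ltW x0)); rewrite lerDr.
by rewrite ler_expR expr2 ler_peMr// ltW.
Qed.

(** Compact intervals that exhaust the positive half-line: at 0 the integrand of
    Gamma may be unbounded, so substitution and integration by parts are applied
    on these intervals.  Starting at 2 makes [lo n < hi n] for all n. *)
Definition lo (n : nat) : R := n.+2%:R^-1.
Definition hi (n : nat) : R := n.+2%:R.

Lemma lo_gt0 n : 0 < lo n. Proof. by rewrite invr_gt0. Qed.

Lemma lo_hi n : lo n < hi n.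
Proof.
apply: (@lt_trans _ _ 1); last by rewrite ltr1n.
by rewrite invf_lt1// ltr1n.
Qed.

Lemma cvg_lo : lo n @[n --> \oo] --> (0 : R).
Proof. by have := @cvg_harmonic R; rewrite -(cvg_shiftS (@harmonic R)). Qed.

Lemma xgauss_lo m : xgauss m.+1 (lo n) @[n --> \oo] --> (0 : R).
Proof.
have <- : xgauss m.+1 0 = 0 by rewrite /xgauss expr0n mul0r.
by apply: (cvg_comp _ _ cvg_lo); exact: xgauss_continuous.
Qed.

Lemma xgauss_hi m : xgauss m (hi n) @[n --> \oo] --> (0 : R).
Proof.
have h : m.+1`!%:R * lo n @[n --> \oo] --> (0 : R).
  by rewrite -[X in _ --> X](mulr0 m.+1`!%:R); apply: cvgM cvg_lo; exact: cvg_cst.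
apply: (squeeze_cvgr _ (cvg_cst (0 : R)) h); near=> n.
by rewrite xgauss_ge0// xgauss_decay// ler1n.
Unshelve. all: by end_near. Qed.

Lemma continuous_itv_integrable (f : R -> R) a b :
  continuous f -> mu.-integrable `[a, b] (EFin \o f).
Proof.
move=> cf; apply: continuous_compact_integrable; first exact: segment_compact.
exact: continuous_subspaceT.
Qed.

Lemma Rintegral_derive (F f : R -> R) (a b : R) : a < b -> continuous f ->
  (forall x : R, is_derive x 1 F (f x)) -> \int[mu]_(x in `[a, b]) f x = F b - F a.
Proof.
move=> ab cf dF.
have cF : continuous F.
  by move=> x; apply: differentiable_continuous; apply/derivable1_diffP; have [] := dF x.
rewrite /Rintegral (continuous_FTC2 (F := F) ab)//.
- exact: continuous_subspaceT.
- split.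
  + by move=> x _; have [] := dF x.
  + exact: cvg_at_right_filter (cF a).
  + exact: cvg_at_left_filter (cF b).
- by move=> x _; rewrite derive1E; have [_ ->] := dF x.
Qed.

Definition truncint (m n : nat) : R := \int[mu]_(x in `[lo n, hi n]) xgauss m x.

(** Integration by parts: x^(m+1) e^(-x^2) vanishes at both ends. *)
Lemma truncint_step m (l : R) : truncint m n @[n --> \oo] --> l ->
  truncint m.+2 n @[n --> \oo] --> m.+1%:R / 2 * l.
Proof.
move=> jl.
have cf : continuous (fun x => m.+1%:R * xgauss m x - 2 * xgauss m.+2 x).
  move=> x; apply: cvgB; apply: cvgM;
    [exact: cvg_cst|exact: xgauss_continuous|exact: cvg_cst|exact: xgauss_continuous].
have E n : truncint m.+2 n =
    m.+1%:R / 2 * truncint m n +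
      (- 2^-1 * xgauss m.+1 (hi n) + 2^-1 * xgauss m.+1 (lo n)).
  have := Rintegral_derive (lo_hi n) cf (is_derive_xgaussS m).
  have cM k (c : R) : continuous (fun x => c * xgauss k x).
    by move=> x; apply: cvgM; [exact: cvg_cst|exact: xgauss_continuous].
  rewrite RintegralB//; [|exact: continuous_itv_integrable..].
  rewrite !RintegralZl//; [|by apply: continuous_itv_integrable; exact: xgauss_continuous..].
  rewrite -/(truncint m n) -/(truncint m.+2 n) => /eqP; rewrite subr_eq addrC -subr_eq => /eqP h.
  have -> : truncint m.+2 n = 2^-1 * (2 * truncint m.+2 n) by field.
  by rewrite -h; field.
under eq_fun do rewrite E.
have -> : m.+1%:R / 2 * l =
  m.+1%:R / 2 * l + (- 2^-1 * 0 + 2^-1 * 0) by rewrite !mulr0 !addr0.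
apply: seq_cvgD; first exact: seq_cvgZ.
by apply: seq_cvgD; apply: seq_cvgZ; [exact: xgauss_hi|exact: xgauss_lo].
Qed.

Lemma truncint1 : truncint 1 n @[n --> \oo] --> (2^-1 : R).
Proof.
have E n : truncint 1 n = - 2^-1 * xgauss 0 (hi n) + 2^-1 * xgauss 0 (lo n).
  have dF (x : R) : is_derive x 1 (fun y : R => - 2^-1 * xgauss 0 y) (xgauss 1 x).
    have -> : (fun y => - 2^-1 * xgauss 0 y) = (- 2^-1 : R) \*: (fun y : R => expR (- y ^+ 2)).
      by apply/funext => y; rewrite /xgauss expr0 mul1r.
    apply: (is_derive_eq (is_deriveZ _ (is_derive_gauss x))).
    by rewrite /GRing.scale/=; field.
  rewrite /truncint (Rintegral_derive (lo_hi n) (@xgauss_continuous 1) dF).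
  by ring.
under eq_fun do rewrite E.
have h0 : xgauss 0 (lo n) @[n --> \oo] --> (1 : R).
  have <- : xgauss 0 0 = 1 by rewrite /xgauss expr0 expr0n oppr0 expR0 mulr1.
  by apply: (cvg_comp _ _ cvg_lo); exact: xgauss_continuous.
have := seq_cvgD (@seq_cvgZ R (- 2^-1) _ _ (xgauss_hi 0)) (@seq_cvgZ R 2^-1 _ _ h0).
by rewrite mulr0 add0r mulr1.
Qed.

Lemma lo_le1 n : lo n <= 1. Proof. by rewrite invf_le1// ler1n. Qed.
Lemma hi_ge1 n : 1 <= hi n. Proof. by rewrite ler1n. Qed.

(** [p] is 1 for the Gaussian integral and 2 for its image under t = x^2. *)
Lemma bigcup_lo_hi (p : nat) : (0 < p)%N ->
  \bigcup_n `[lo n ^+ p, hi n ^+ p]%classic = `]0, +oo[%classic.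
Proof.
move=> p0; apply/seteqP; split => [x [n _]|x] /=.
  rewrite !in_itv/= andbT => /andP[+ _]; apply: lt_le_trans.
  by rewrite exprn_gt0// lo_gt0.
rewrite in_itv/= andbT => x0.
have xn : exists n : nat, Num.max x x^-1 <= hi n.
  exists (Num.truncn (Num.max x x^-1)); apply/ltW.
  apply: lt_trans (truncnS_gt _) _; by rewrite ltr_nat.
case: xn => n; rewrite ge_max => /andP[xn xVn]; exists n => //=.
rewrite in_itv/=; apply/andP; split.
  apply: (@le_trans _ _ (lo n)).
    by rewrite ler_iXnr// ?lo_le1// ltW// lo_gt0.
  by rewrite /lo invf_ple// posrE.
by apply: le_trans xn _; rewrite ler_eXnr// hi_ge1.
Qed.

Lemma cvg_integral_lo_hi (p : nat) (f : R -> R) : (0 < p)%N ->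
  measurable_fun (`]0, +oo[%classic : set R) f -> (forall x, 0 < x -> 0 <= f x) ->
  (\int[mu]_(x in `[(lo n ^+ p)%R, (hi n ^+ p)%R]) (f x)%:E @[n --> \oo] -->
   \int[mu]_(x in `]0%R, +oo[) (f x)%:E)%E.
Proof.
move=> p0 mf f0; rewrite -(bigcup_lo_hi p0).
apply: ge0_nondecreasing_set_cvg_integral.
- move=> n m nm; rewrite subsetEset; apply: subset_itv; rewrite bnd_simp.
    have [ln lm] := (ltW (lo_gt0 n), ltW (lo_gt0 m)).
    by rewrite lerXn2r// lef_pV2 ?posrE// ler_nat.
  by rewrite lerXn2r// ?nnegrE// ler_nat.
- by [].
- move=> n; apply/measurable_EFinP; apply: measurable_funS mf => //.
  by rewrite -(bigcup_lo_hi p0) => x xn; exists n.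
- move=> n x /=; rewrite in_itv/= lee_fin => /andP[xn _]; apply: f0.
  by apply: lt_le_trans xn; rewrite exprn_gt0// lo_gt0.
Qed.

Lemma truncintE m n : (truncint m n)%:E = (\int[mu]_(x in `[lo n, hi n]) (xgauss m x)%:E)%E.
Proof.
rewrite /truncint /Rintegral fineK//; apply: integrable_fin_num => //.
by apply: continuous_itv_integrable; exact: xgauss_continuous.
Qed.

Lemma truncint0 : truncint 0 n @[n --> \oo] --> Num.sqrt pi / 2.
Proof.
have mg : measurable_fun (`]0, +oo[%classic : set R) (xgauss 0).
  by apply: open_continuous_measurable_fun => // x _; exact: xgauss_continuous.
have := @cvg_integral_lo_hi 1 _ isT mg (fun x x0 => xgauss_ge0 0 (ltW x0)).
rewrite integral_itv_obnd_cbnd; last exact/measurable_EFinP.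
have E : xgauss 0 = @gauss_fun R by apply/funext => x; rewrite /xgauss expr0 mul1r.
rewrite [X in _ --> X](_ : _ = (Num.sqrt pi / 2)%:E); last by rewrite E integral0y_gauss.
under eq_fun do rewrite !expr1 -truncintE.
by move=> h; apply: (fine_cvg (f := EFin \o truncint 0)).
Qed.

Definition gammaf (m : nat) (t : R) : R := t `^ (m.+1%:R / 2 - 1) * expR (- t).

Lemma gammaf_ge0 m t : 0 <= gammaf m t.
Proof. by rewrite mulr_ge0 ?powR_ge0 ?expR_ge0. Qed.

Lemma gammaf_continuous m t : 0 < t -> {for t, continuous (gammaf m)}.
Proof.
move=> t0; rewrite /continuous_at /gammaf; apply: cvgM.
  have [+ _] := is_derive1_powR (m.+1%:R / 2 - 1) t0.
  by move=> /derivable1_diffP/differentiable_continuous.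
apply: (continuous_comp (f := fun y : R => - y) (g := expR)).
  exact: opp_continuous.
exact: continuous_expR.
Qed.

Lemma gammaf_sqr m x : 0 < x -> gammaf m (x ^+ 2) * (2 * x) = 2 * xgauss m x.
Proof.
move=> x0; have x0' := ltW x0; rewrite /gammaf /xgauss.
have -> : (x ^+ 2) `^ (m.+1%:R / 2 - 1) = x ^+ m / x.
  rewrite -(powR_mulrn 2 x0') -powRrM.
  have -> : 2%:R * (m.+1%:R / 2 - 1) = m%:R - 1 :> R.
    by rewrite -(natr1 m); field.
  rewrite powRB; last by rewrite (gt_eqF x0) implybT.
  by rewrite powR_mulrn// powRr1.
by field; rewrite gt_eqF.
Qed.

Lemma gammaf_subst m n :
  (\int[mu]_(t in `[(lo n ^+ 2)%R, (hi n ^+ 2)%R]) (gammaf m t)%:E = (2 * truncint m n)%:E)%E.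
Proof.
have dsq (x : R) : is_derive x 1 (fun y : R => y ^+ 2) (2 * x).
  have := is_deriveX 2 (is_derive_id x 1); rewrite exprfctE => h.
  by apply: (is_derive_eq h); rewrite /GRing.scale/= mulr1 expr1.
have dsqE : ((fun y : R => y ^+ 2)^`())%classic = fun x => 2 * x.
  by apply/funext => x; rewrite derive1E; have [_ ->] := dsq x.
have c2 : continuous (fun x : R => 2 * x).
  by move=> x; apply: cvgM; [exact: cvg_cst|exact: cvg_id].
have csq : continuous (fun x : R => x ^+ 2) by exact: exprn_continuous.
rewrite (@integration_by_substitution_increasing R (fun x => x ^+ 2)
  (gammaf m) _ _ (ltW (lo_hi n))).
- rewrite dsqE EFinM truncintE -integralZl//; last first.
    by apply: continuous_itv_integrable; exact: xgauss_continuous.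
  apply: eq_integral => x; rewrite inE/= in_itv/= => /andP[xn _].
  by rewrite -EFinM -gammaf_sqr//; apply: lt_le_trans xn; exact: lo_gt0.
- move=> x y; rewrite !in_itv/= => /andP[xn _] /andP[yn _] xy.
  have x0 : 0 < x by apply: lt_le_trans xn; exact: lo_gt0.
  by rewrite ltrXn2r// ltW.
- by move=> x _; rewrite dsqE; exact: c2.
- by rewrite dsqE; apply/cvg_ex; exists (2 * lo n); apply: cvg_at_right_filter; exact: c2.
- by rewrite dsqE; apply/cvg_ex; exists (2 * hi n); apply: cvg_at_left_filter; exact: c2.
- split.
  + by move=> x _; have [] := dsq x.
  + by apply: cvg_at_right_filter; exact: csq.
  + by apply: cvg_at_left_filter; exact: csq.
- apply: continuous_in_subspaceT => x; rewrite inE/= in_itv/= => /andP[xn _].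
  apply: gammaf_continuous; apply: lt_le_trans xn; by rewrite exprn_gt0// lo_gt0.
Qed.

Lemma Gamma_truncint m (l : R) : truncint m n @[n --> \oo] --> l ->
  Gamma (m.+1%:R / 2) = 2 * l.
Proof.
move=> jl; rewrite /Gamma /Rintegral.
have mg : measurable_fun (`]0, +oo[%classic : set R) (gammaf m).
  apply: open_continuous_measurable_fun => //.
  by move=> t; rewrite inE/= in_itv/= andbT; exact: gammaf_continuous.
have h1 := @cvg_integral_lo_hi 2 _ isT mg (fun x _ => gammaf_ge0 m x).
have h2 : ((2 * truncint m n)%:E @[n --> \oo] --> (2 * l)%:E)%E.
  by apply: cvg_EFin; [near=> n|exact: seq_cvgZ].
suff -> : (\int[mu]_(x in `]0%R, +oo[) (gammaf m x)%:E = (2 * l)%:E)%E by [].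
apply: cvg_unique h1 _ => //=.
by under eq_fun do rewrite gammaf_subst.
Unshelve. all: by end_near. Qed.

(** Locked, as conversion would otherwise unfold the integral. *)
Definition GammaHalf : nat -> R := locked (fun a => Gamma (a%:R / 2)).

Lemma GammaHalfE a : GammaHalf a = Gamma (a%:R / 2). Proof. by rewrite /GammaHalf -lock. Qed.

Lemma GammaHalf_truncint m (l : R) : truncint m n @[n --> \oo] --> l -> GammaHalf m.+1 = 2 * l.
Proof. by rewrite GammaHalfE => /Gamma_truncint. Qed.

Lemma truncint_cvg m : truncint m n @[n --> \oo] --> GammaHalf m.+1 / 2.
Proof.
have h (l : R) : truncint m n @[n --> \oo] --> l ->
    truncint m n @[n --> \oo] --> GammaHalf m.+1 / 2.
  by move=> jl; rewrite (GammaHalf_truncint jl) (mulrC 2) mulfK ?pnatr_eq0.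
suff [l jl] : exists l : R, truncint m n @[n --> \oo] --> l by exact: h jl.
have : (exists l : R, truncint m n @[n --> \oo] --> l) /\
       (exists l : R, truncint m.+1 n @[n --> \oo] --> l).
  elim: m {h} => [|m [[l jl] h2]].
    by split; [exists (Num.sqrt pi / 2); exact: truncint0|exists 2^-1; exact: truncint1].
  by split => //; exists (m.+1%:R / 2 * l); exact: truncint_step.
by case.
Qed.

Lemma GammaHalf1 : GammaHalf 1 = Num.sqrt pi.
Proof. by rewrite (GammaHalf_truncint truncint0) mulrCA divff ?mulr1 ?pnatr_eq0. Qed.

Lemma GammaHalf2 : GammaHalf 2 = 1.
Proof. by rewrite (GammaHalf_truncint truncint1) divff ?pnatr_eq0. Qed.

Lemma GammaHalf_step a : (0 < a)%N -> GammaHalf a.+2 = a%:R / 2 * GammaHalf a.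
Proof.
by case: a => // m _; rewrite (GammaHalf_truncint (truncint_step (@truncint_cvg m))); field.
Qed.

Lemma GammaHalf_gt0 a : (0 < a)%N -> 0 < GammaHalf a.
Proof.
case: a => // m _.
have : 0 < GammaHalf m.+1 /\ 0 < GammaHalf m.+2.
  elim: m => [|m [h1 h2]].
    by rewrite GammaHalf1 GammaHalf2 ltr01 sqrtr_gt0 pi_gt0.
  by split => //; rewrite GammaHalf_step// mulr_gt0// divr_gt0 ?ltr0n.
by case.
Qed.

Lemma GammaHalf_neq0 a : (0 < a)%N -> GammaHalf a != 0.
Proof. by move=> /GammaHalf_gt0 /lt0r_neq0. Qed.

(** Pointwise, c + x^2 / c - 2 x = (x - c)^2 / c. *)
Lemma truncint_amgm m n (c : R) : 0 < c ->
  2 * truncint m.+1 n <= c * truncint m n + c^-1 * truncint m.+2 n.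
Proof.
move=> c0.
have cM k (d : R) : continuous (fun x => d * xgauss k x).
  by move=> x; apply: cvgM; [exact: cvg_cst|exact: xgauss_continuous].
have iM k (d : R) : mu.-integrable `[lo n, hi n] (EFin \o (fun x => d * xgauss k x)).
  exact: continuous_itv_integrable.
have ig k : mu.-integrable `[lo n, hi n] (EFin \o xgauss k).
  by apply: continuous_itv_integrable; exact: xgauss_continuous.
rewrite /truncint -!RintegralZl// -RintegralD//; apply: le_Rintegral => //.
  apply: continuous_itv_integrable => x.
  by apply: cvgD; exact: cM.
move=> x; rewrite /= in_itv/= => /andP[xn _].
have x0 : 0 <= x by apply: le_trans xn; exact/ltW/lo_gt0.
rewrite -subr_ge0.
have -> : c * xgauss m x + c^-1 * xgauss m.+2 x - 2 * xgauss m.+1 x =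
   c^-1 * (xgauss m x * (x - c) ^+ 2) :> R.
  by rewrite /xgauss !exprS; field; rewrite gt_eqF.
by rewrite mulr_ge0 ?invr_ge0 ?(ltW c0)// mulr_ge0 ?xgauss_ge0// sqr_ge0.
Qed.

(** Optimizing the parameter in [truncint_amgm] gives Cauchy-Schwarz. *)
Lemma GammaHalf_log_convex a : (0 < a)%N ->
  GammaHalf a.+1 ^+ 2 <= GammaHalf a * GammaHalf a.+2.
Proof.
case: a => // m _.
have x0 := @GammaHalf_gt0 m.+1 isT; have y0 := @GammaHalf_gt0 m.+2 isT.
pose c := GammaHalf m.+2 / GammaHalf m.+1; have c0 : 0 < c by rewrite divr_gt0.
have h : 2 * (GammaHalf m.+2 / 2) <= c * (GammaHalf m.+1 / 2) + c^-1 * (GammaHalf m.+3 / 2).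
  apply: (ler_cvg_to (seq_cvgZ (c := 2) (@truncint_cvg m.+1))
    (seq_cvgD (seq_cvgZ (c := c) (@truncint_cvg m)) (seq_cvgZ (c := c^-1) (@truncint_cvg m.+2)))).
  by near=> n; exact: truncint_amgm.
move: h x0 y0; rewrite /c.
move: (GammaHalf m.+1) (GammaHalf m.+2) (GammaHalf m.+3) => x y z h x0 y0.
have : 2 * y * (2 * (y / 2)) <= 2 * y * (y / x * (x / 2) + (y / x)^-1 * (z / 2)).
  by rewrite ler_pM2l// mulr_gt0.
have -> : 2 * y * (2 * (y / 2)) = y ^+ 2 + y ^+ 2 by field.
have -> : 2 * y * (y / x * (x / 2) + (y / x)^-1 * (z / 2)) = y ^+ 2 + x * z.
  by field; rewrite !gt_eqF.
by rewrite lerD2l.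
Unshelve. all: by end_near. Qed.

Lemma invpow_GammaHalf a n : (0 < a)%N ->
  invpow R a n = GammaHalf (a + 2 * n) / (GammaHalf a * n`!%:R).
Proof.
move=> a0; elim: n => [|n ih].
  by rewrite invpow0 muln0 addn0 mulr1 divff ?GammaHalf_neq0.
rewrite invpowS ih mulnS addnCA add2n GammaHalf_step ?addn_gt0 ?a0//.
rewrite factS natrD !natrM; field.
by rewrite GammaHalf_neq0//= nat1r !pnatr_eq0/= -lt0n fact_gt0.
Qed.

(** Consecutive ratios q_b satisfy q_b q_(b+1) = b/2 and, by log-convexity, are
    nondecreasing; hence q_(b-1)^2 <= (b-1)/2 <= q_b^2 <= b/2. *)
Lemma GammaHalf_ratio_bounds b : (1 < b)%N ->
  (b.-1%:R / 2 <= (GammaHalf b.+1 / GammaHalf b) ^+ 2 <= b%:R / 2)%R.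
Proof.
case: b => [|[|b]]// _ /=.
have x0 := @GammaHalf_gt0 b.+1 isT; have y0 := @GammaHalf_gt0 b.+2 isT.
have l1 := @GammaHalf_log_convex b.+1 isT; have l2 := @GammaHalf_log_convex b.+2 isT.
rewrite (GammaHalf_step (ltn0Sn b.+1)) in l2.
rewrite (GammaHalf_step (ltn0Sn b)) in l1 l2 *; move: x0 y0 l1 l2.
have b0 : 0 < b.+1%:R / 2 :> R by rewrite divr_gt0 ?ltr0n.
move: (GammaHalf b.+1) (GammaHalf b.+2) (b.+1%:R / 2) b0 (b.+2%:R / 2) => x y u u0 v x0 y0 l1 l2.
have y2 : 0 < y ^+ 2 by rewrite exprn_gt0.
rewrite expr_div_n ler_pdivlMr// ler_pdivrMr//; apply/andP; split.
  have -> : (u * x) ^+ 2 = u * (x * (u * x)) by ring.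
  by rewrite ler_pM2l.
by have -> : v * y ^+ 2 = y * (v * y) by ring.
Qed.

Lemma invpow_growth_step a : (0 < a)%N ->
  invpow R a.+1 n / (invpow R a n * Num.sqrt n%:R) @[n --> \oo] -->
  GammaHalf a / GammaHalf a.+1.
Proof.
move=> a0.
pose q n : R := GammaHalf (a + 2 * n).+1 / GammaHalf (a + 2 * n).
have q0 n : 0 < q n by rewrite divr_gt0// GammaHalf_gt0// addn_gt0 a0.
have h : q n ^+ 2 / n%:R @[n --> \oo] --> (1 : R).
  have bd (e : R) : 1 + e / 2 * (n%:R)^-1 @[n --> \oo] --> (1 : R).
    have i0 : (n%:R)^-1 @[n --> \oo] --> (0 : R).
      by apply: (@seq_cvgS _ (fun n => (n%:R)^-1)); exact: cvg_harmonic.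
    have := seq_cvgD (@seq_cvg_cst R 1) (seq_cvgZ (c := e / 2) i0).
    by rewrite mulr0 addr0.
  apply: (squeeze_cvgr _ (bd (a%:R - 1)) (bd a%:R)); near=> n.
  have n0 : (0 < n)%N by near: n; exact: nbhs_infty_gt.
  have n0' : 0 < n%:R :> R by rewrite ltr0n.
  have b1 : (1 < a + 2 * n)%N by lia.
  have := GammaHalf_ratio_bounds b1; rewrite -/(q n).
  have -> : (a + 2 * n).-1%:R = a%:R - 1 + 2 * n%:R :> R.
    have -> : (a + 2 * n).-1 = (a.-1 + 2 * n)%N by lia.
    by rewrite natrD natrM -(natrB _ a0) subn1.
  rewrite natrD natrM => /andP[h1 h2].
  have E (e : R) : (1 + e / 2 / n%:R) * n%:R = (e + 2 * n%:R) / 2.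
    by field; rewrite gt_eqF.
  by rewrite ler_pdivlMr// ler_pdivrMr// !E h1 h2.
have h' : q n / Num.sqrt n%:R @[n --> \oo] --> (1 : R).
  have : Num.sqrt (q n ^+ 2 / n%:R) @[n --> \oo] --> Num.sqrt (1 : R).
    by apply: (cvg_comp _ Num.sqrt h); exact: sqrt_continuous.
  rewrite sqrtr1; apply: seq_cvg_eq; near=> n.
  by rewrite sqrtrM ?sqr_ge0// sqrtr_sqr ger0_norm ?ltW// sqrtrV.
have := seq_cvgZ (c := GammaHalf a / GammaHalf a.+1) h'; rewrite mulr1.
apply: seq_cvg_eq; near=> n; rewrite !invpow_GammaHalf// addSn /q; field.
rewrite !GammaHalf_neq0 ?addn_gt0 ?a0//= pnatr_eq0 -lt0n fact_gt0/= ?andbT.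
by rewrite gt_eqF// sqrtr_gt0 ltr0n; near: n; exact: nbhs_infty_gt.
Unshelve. all: by end_near. Qed.

Lemma invpow_growth a : (0 < a)%N ->
  invpow R a n / (invpow R 1 n * Num.sqrt n%:R ^+ a.-1) @[n --> \oo] -->
  Num.sqrt pi / GammaHalf a.
Proof.
case: a => // a _; elim: a => [|a ih].
  rewrite GammaHalf1 divff ?gt_eqF ?sqrtr_gt0 ?pi_gt0//.
  under eq_fun do rewrite expr0 mulr1 divff ?invpow_neq0//; exact: cvg_cst.
have := seq_cvgM ih (@invpow_growth_step a.+1 isT).
rewrite mulrA divfK ?GammaHalf_neq0//; apply: seq_cvg_eq; near=> n.
have n0 : Num.sqrt n%:R != 0 :> R.
  by rewrite gt_eqF// sqrtr_gt0 ltr0n; near: n; exact: nbhs_infty_gt.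
by rewrite /= exprSr; field; rewrite !invpow_neq0// expf_neq0 n0.
Unshelve. all: by end_near. Qed.

End GammaHalfIntegers.
(** * Sequences asymptotic to a multiple of invpow *)

Section Regular.
Variable R : realType.
Implicit Types (x y : nat -> R) (A B : R).

(** For a > 0 this says that x_n ~ A n^(a/2-1) / Gamma(a/2) when A is not zero;
    A = 0 is allowed and expresses negligibility. *)
Definition asymp (a : nat) x A : Prop := x n / invpow R a n @[n --> \oo] --> A.

Lemma asympD a x y A B : asymp a x A -> asymp a y B -> asymp a (x \+ y) (A + B).
Proof.
rewrite /asymp => hx hy; under eq_fun do rewrite mulrDl.
exact: (cvgD hx hy).
Qed.

Lemma asympZ a (c : R) x A : asymp a x A -> asymp a (fun n => c * x n) (c * A).
Proof.
rewrite /asymp => hx; under eq_fun do rewrite -mulrA.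
exact: (seq_cvgM (cvg_cst c) hx).
Qed.

Lemma asympN a x A : asymp a x A -> asymp a (fun n => - x n) (- A).
Proof.
move=> hx; have := asympZ (c := - 1) hx; rewrite mulN1r.
by congr asymp; apply/funext => n; rewrite mulN1r.
Qed.

Lemma asymp_cst0 a : asymp a (fun=> 0) 0.
Proof. by rewrite /asymp; under eq_fun do rewrite mul0r; exact: cvg_cst. Qed.

Lemma asymp_sum a (I : eqType) (r : seq I) (P : pred I) (x : I -> nat -> R) (A : I -> R) :
  (forall i, i \in r -> P i -> asymp a (x i) (A i)) ->
  asymp a (fun n => \sum_(i <- r | P i) x i n) (\sum_(i <- r | P i) A i).
Proof.
elim: r => [|i r ih] h.
  rewrite big_nil (_ : (fun _ => _) = fun=> 0); first exact: asymp_cst0.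
  by apply/funext => n; rewrite big_nil.
have {}ih := ih (fun j jr => h j (mem_behead (s := i :: r) jr)).
rewrite big_cons (_ : (fun n => _) =
  fun n => (if P i then x i n else 0) + \sum_(j <- r | P j) x j n); last first.
  by apply/funext => n; rewrite big_cons; case: ifP; rewrite ?add0r.
case: ifPn => Pi; first by apply: asympD => //; apply: h; rewrite ?mem_head.
by rewrite (_ : (fun _ => _) = fun n => \sum_(j <- r | P j) x j n)//;
  apply/funext => n; rewrite add0r.
Qed.

Lemma asymp_invpow a : (0 < a)%N -> asymp a (invpow R a) 1.
Proof.
move=> a0; rewrite /asymp; under eq_fun do rewrite divff ?invpow_neq0//.
exact: cvg_cst.
Qed.

Lemma cvg_sqrtn_inv : (Num.sqrt n%:R : R)^-1 @[n --> \oo] --> (0 : R).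
Proof.
apply/cvgrPdist_lt => e e0; near=> n; rewrite sub0r normrN.
have n0 : 0 < Num.sqrt n%:R :> R by rewrite sqrtr_gt0 ltr0n; near: n; exact: nbhs_infty_gt.
rewrite ger0_norm ?invr_ge0 ?ltW// invf_plt ?posrE//.
rewrite -[ltLHS]ger0_norm ?invr_ge0 ?ltW// -sqrtr_sqr ltr_sqrt//.
  near: n; exact: nbhs_infty_gtr.
by rewrite ltr0n; near: n; exact: nbhs_infty_gt.
Unshelve. all: by end_near. Qed.

Lemma invpow_lower a b : (0 < b < a)%N -> asymp a (invpow R b) 0.
Proof.
case/andP=> b0 ba; have a0 := ltn_trans b0 ba; rewrite /asymp.
pose la : R := Num.sqrt pi / GammaHalf R a.
pose lb : R := Num.sqrt pi / GammaHalf R b.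
have la0 : la != 0.
  by rewrite mulf_neq0 ?invr_neq0// gt_eqF ?GammaHalf_gt0// sqrtr_gt0 pi_gt0.
have := seq_cvgM (seq_cvgM (@invpow_growth R _ b0) (seq_cvgV la0 (@invpow_growth R _ a0)))
  (cvg_pow (m := (a - b)%N) cvg_sqrtn_inv).
rewrite expr0n subn_eq0 leqNgt ba mulr0; apply: seq_cvg_eq.
near=> n => /=.
have n0 : Num.sqrt n%:R != 0 :> R.
  by rewrite gt_eqF// sqrtr_gt0 ltr0n; near: n; exact: nbhs_infty_gt.
have -> : a.-1 = (b.-1 + (a - b))%N by lia.
rewrite exprD exprVn; field.
by rewrite !invpow_neq0// !expf_neq0.
Unshelve. all: by end_near. Qed.

Lemma asymp_lower a b x A : (0 < b < a)%N -> asymp b x A -> asymp a x 0.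
Proof.
move=> /[dup] /invpow_lower h /andP[b0 _] hx; have := seq_cvgM hx h; rewrite mulr0.
rewrite /asymp; under eq_fun do rewrite mulrA divfK ?invpow_neq0//.
exact.
Qed.

Lemma cvg_affine_ratio (u v p q : R) : p != 0 -> (forall n, p * n%:R + q != 0) ->
  (u * n%:R + v) / (p * n%:R + q) @[n --> \oo] --> u / p.
Proof.
move=> p0 h.
have i0 : (n.+1%:R : R)^-1 @[n --> \oo] --> (0 : R) by exact: cvg_harmonic.
apply: (@seq_cvgS R (fun n => (u * n%:R + v) / (p * n%:R + q))).
have c1 (s t : R) : s + t * (n.+1%:R)^-1 @[n --> \oo] --> s.
  rewrite -[X in _ --> X]addr0 -[X in _ + X](mulr0 t).
  by apply: cvgD; [exact: cvg_cst|apply: cvgM => //; exact: cvg_cst].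
have := seq_cvgM (c1 u v) (seq_cvgV p0 (c1 p q)); apply: seq_cvg_eq; near=> n => /=.
have n0 : n.+1%:R != 0 :> R by rewrite pnatr_eq0.
have := h n.+1; move: (n.+1%:R : R) n0 => N n0 hn.
by field; rewrite n0 hn.
Unshelve. all: by end_near. Qed.

Definition shift x (n : nat) : R := if n is n'.+1 then x n' else 0.

Lemma asymp_shift a x A : (0 < a)%N -> asymp a x A -> asymp a (shift x) A.
Proof.
move=> a0 hx; rewrite /asymp; apply: (@seq_cvgS R (fun n => shift x n / invpow R a n)) => /=.
have h : (2 * n%:R + 2) / (2 * n%:R + a%:R) @[n --> \oo] --> (2 / 2 : R).
  apply: cvg_affine_ratio; rewrite ?pnatr_eq0// => n.
  by rewrite gt_eqF// ltr_wpDl ?mulr_ge0// ltr0n.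
have := seq_cvgM hx h; rewrite divff ?pnatr_eq0// mulr1.
apply: seq_cvg_eq; near=> n => /=; rewrite invpowS -(natr1 n).
field; rewrite natr1 pnatr_eq0/= invpow_neq0// andbT gt_eqF//.
by rewrite ltr_wpDr ?mulr_ge0// ltr0n.
Unshelve. all: by end_near. Qed.

(** [invpow a n / invpow (a - 2) n] equals (a - 2 + 2n) / (a - 2). *)
Lemma asymp_divn a x A : (2 < a)%N -> asymp a x A ->
  asymp (a - 2) (fun n => x n / (2 * n)%:R) (A / (a - 2)%:R).
Proof.
move=> a2; pose b := (a - 2)%N; have -> : a = (b + 2)%N by rewrite subnK// ltnW.
have b0 : (0 < b)%N by rewrite subn_gt0.
rewrite addnK => hx; have bN0 : b%:R != 0 :> R by rewrite pnatr_eq0 -lt0n.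
have h : (2 * n%:R + b%:R) / (2 * n%:R) @[n --> \oo] --> (2 / 2 : R).
  apply: (@seq_cvgS R (fun n => (2 * n%:R + b%:R) / (2 * n%:R))).
  have -> : (fun n => (2 * n.+1%:R + b%:R) / (2 * n.+1%:R) : R) =
            (fun n => (2 * n%:R + (2 + b%:R)) / (2 * n%:R + 2)).
    apply/funext => n; have -> : 2 * n.+1%:R = 2 * n%:R + 2 :> R by rewrite -(natr1 n); ring.
    by rewrite -addrA.
  by apply: cvg_affine_ratio => [|n]; rewrite ?pnatr_eq0// gt_eqF// ltr_wpDl ?mulr_ge0.
have := seq_cvgM (seq_cvgM hx h) (@seq_cvg_cst R b%:R^-1).
rewrite divff ?pnatr_eq0// mulr1; apply: seq_cvg_eq; near=> n => /=; rewrite invpow_raise2//.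
have n0 : n%:R != 0 :> R by rewrite pnatr_eq0 -lt0n; near: n; exact: nbhs_infty_gt.
rewrite natrM; field; rewrite invpow_neq0//= n0 bN0/= gt_eqF//.
by rewrite ltr_wpDr ?mulr_ge0// ltr0n.
Unshelve. all: by end_near. Qed.

Lemma asymp_bound a x A : (0 < a)%N -> asymp a x A ->
  exists2 C : R, 0 <= C & forall n, `|x n| <= C * invpow R a n.
Proof.
move=> a0 hx; have /cvg_seq_bounded := cvgP _ hx.
move=> [C [_ hC]]; exists (`|C| + 1) => [|n]; first by rewrite addr_ge0.
have := hC (`|C| + 1); rewrite (le_lt_trans (ler_norm _)) ?ltrDl//.
move=> /(_ isT n I) /=; rewrite normrM normfV (gtr0_norm (invpow_gt0 R n a0)).
by rewrite ler_pdivrMr// invpow_gt0.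
Qed.

(** The indices beyond some N contribute at most an arbitrarily small multiple of
    [conv (invpow a) (invpow b)].  Each of the finitely many others contributes a
    shift of [invpow b], of lower order. *)
Lemma asymp_conv_small a b x y B : (0 < a)%N -> (0 < b)%N ->
  asymp a x 0 -> asymp b y B -> asymp (a + b) (conv x y) 0.
Proof.
move=> a0 b0 hx hy; have [C C0 yC] := asymp_bound b0 hy.
have ab0 : (0 < a + b)%N by rewrite addn_gt0 a0.
apply/cvgr0Pnorm_lt => e e0.
pose e' := e / (C + 1) / 2.
have C1 : 0 < C + 1 by rewrite ltr_wpDl.
have e'0 : 0 < e' by rewrite !divr_gt0.
have /cvgr0Pnorm_lt/(_ _ e'0)[N _ hN] := hx.
pose w n := \sum_(i < N) `|x i| * iter i shift (invpow R b) n.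
have hw : asymp (a + b) w 0.
  have -> : 0 = \sum_(i < N) `|x i| * 0 :> R by rewrite big1// => i _; rewrite mulr0.
  apply: asymp_sum => i _ _; apply: asympZ; apply: (@asymp_lower _ b _ 1).
    by rewrite b0 -[X in (X < _)%N]add0n ltn_add2r.
  elim: (nat_of_ord i) => [|j ih]; first exact: asymp_invpow.
  by rewrite iterS; apply: asymp_shift.
have iterE i n : (i <= n)%N -> iter i shift (invpow R b) n = invpow R b (n - i).
  elim: i n => [|i ih] [|n]//= ?; first by rewrite subSS ih.
have key n : (N <= n)%N -> `|conv x y n| <= C * (e' * invpow R (a + b) n + w n).
  move=> Nn; apply: le_trans (ler_norm_sum _ _ _) _.
  have -> : invpow R (a + b) n = conv (invpow R a) (invpow R b) n by rewrite conv_invpow.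
  rewrite {1}/conv big_distrr/= mulrDr.
  have -> : C * w n = \sum_(i < n.+1) if (i < N)%N then C * (`|x i| * invpow R b (n - i)) else 0.
    rewrite -big_mkcond/= /w big_distrr/=.
    rewrite (big_ord_widen _ (fun i => C * (`|x i| * iter i shift (invpow R b) n)) (leqW Nn)).
    by apply: eq_bigr => i iN; rewrite iterE// -ltnS.
  rewrite big_distrr/= -big_split/=; apply: ler_sum => i _.
  rewrite normrM.
  have h1 : `|x i| * `|y (n - i)%N| <= C * (`|x i| * invpow R b (n - i)).
    by rewrite mulrCA; apply: ler_wpM2l.
  case: ifPn => iN.
    apply: le_trans h1 _; rewrite lerDr mulr_ge0// mulr_ge0 ?ltW// mulr_gt0// invpow_gt0//.
  rewrite addr0; apply: le_trans h1 _; rewrite ler_wpM2l//.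
  rewrite mulrA ler_wpM2r ?invpow_ge0//.
  have := hN i; rewrite -leqNgt in iN => /(_ iN)/=.
  rewrite normrM normfV (gtr0_norm (invpow_gt0 R i a0)) => /ltW.
  by rewrite ler_pdivrMr// invpow_gt0.
have /cvgr0Pnorm_lt/(_ _ e'0)[M _ hM] := hw.
near=> n.
have g0 := invpow_gt0 R n ab0.
have Nn : (N <= n)%N by near: n; exact: nbhs_infty_ge.
have Mn : (M <= n)%N by near: n; exact: nbhs_infty_ge.
rewrite normrM normfV (gtr0_norm g0) ltr_pdivrMr//.
apply: le_lt_trans (key _ Nn) _.
have /= := hM _ Mn; rewrite normrM normfV (gtr0_norm g0) ltr_pdivrMr// => hw'.
apply: (@le_lt_trans _ _ (C * (2 * e' * invpow R (a + b) n))).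
  rewrite ler_wpM2l// -mulrA [leRHS]mulr_natl mulr2n lerD2l.
  by apply: le_trans (ler_norm _) (ltW hw').
rewrite mulrA ltr_pM2r//.
have -> : C * (2 * e') = e * (C / (C + 1)) by rewrite /e'; field; rewrite gt_eqF.
by rewrite gtr_pMr// ltr_pdivrMr// mul1r ltrDl.
Unshelve. all: by end_near. Qed.

(** Subtracting the main terms leaves two products with a negligible factor. *)
Lemma asymp_conv a b x y A B : (0 < a)%N -> (0 < b)%N ->
  asymp a x A -> asymp b y B -> asymp (a + b) (conv x y) (A * B).
Proof.
move=> a0 b0 hx hy; have ab0 : (0 < a + b)%N by rewrite addn_gt0 a0.
have small c z D : (0 < c)%N -> asymp c z D -> asymp c (z \+ (fun n => - D * invpow R c n)) 0.
  by move=> c0 /asympD /(_ (asympZ (c := - D) (asymp_invpow c0))); rewrite mulr1 subrr.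
have xE : x = (x \+ (fun n => - A * invpow R a n)) \+ (fun n => A * invpow R a n).
  by apply/funext => n /=; rewrite mulNr subrK.
have yE : y = (y \+ (fun n => - B * invpow R b n)) \+ (fun n => B * invpow R b n).
  by apply/funext => n /=; rewrite mulNr subrK.
rewrite xE convDl -[A * B]add0r; apply: asympD.
  exact: (asymp_conv_small a0 b0 (small _ _ _ a0 hx) hy).
rewrite convZl; apply: asympZ; rewrite yE convDr -[X in asymp _ _ X]add0r; apply: asympD.
  by rewrite convC addnC; exact: (asymp_conv_small b0 a0 (small _ _ _ b0 hy) (asymp_invpow a0)).
rewrite convZr conv_invpow -[X in asymp _ _ X]mulr1; apply: asympZ; exact: asymp_invpow.
Qed.

(** If u = U invpow a, the sums S_n = p_n - u_n satisfy
    S_(n+1) = S_n (1 + 1/(2(n+1))) + u_n / (2(n+1)), with solution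
    U/(a-3) (invpow a - invpow 3).  In general [D] measures the deviation
    from U/(a-3) invpow a; it is bounded by a supersolution, namely a small
    multiple of [invpow a] plus a solution of the homogeneous equation. *)
Lemma asymp_volterra a u p (U : R) : (3 < a)%N -> asymp a u U ->
  (forall n, p n = u n + \sum_(j < n) p j / (2 * j.+1)%:R) ->
  asymp a p (U * (a - 2)%:R / (a - 3)%:R).
Proof.
move=> a3 hu pE; have a0 : (0 < a)%N by apply: leq_trans a3.
pose c : R := (a - 3)%:R; have c0 : 0 < c by rewrite ltr0n subn_gt0.
have aE : a%:R = c + 3 :> R by rewrite /c -natrD subnK// ltnW.
pose S n := \sum_(j < n) p j / (2 * j.+1)%:R.
pose D n := S n - U / c * invpow R a n.
have SS n : D n.+1 = D n * (1 + (2 * n.+1)%:R^-1) +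
    (u n - U * invpow R a n) / (2 * n.+1)%:R.
  rewrite /D /S big_ord_recr/= -/(S n) pE -/(S n) invpowS aE natrM.
  by field; rewrite nat1r pnatr_eq0/= gt_eqF.
have g3S n : invpow R 3 n.+1 = invpow R 3 n * (1 + (2 * n.+1)%:R^-1).
  by rewrite invpowS natrM -(natr1 n); field; rewrite natr1 pnatr_eq0.
have gaS n : c^-1 * invpow R a n.+1 =
    c^-1 * invpow R a n * (1 + (2 * n.+1)%:R^-1) + invpow R a n / (2 * n.+1)%:R.
  by rewrite invpowS aE natrM; field; rewrite nat1r pnatr_eq0/= gt_eqF.
suff hD : asymp a D 0.
  have -> : p = u \+ (D \+ (fun n => U / c * invpow R a n)).
    by apply/funext => n; rewrite pE /D/= subrK.
  have -> : U * (a - 2)%:R / c = U + (0 + U / c * 1).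
    have -> : (a - 2)%:R = c + 1 :> R by rewrite /c natr1; congr _%:R; lia.
    by field; rewrite gt_eqF.
  by apply: asympD => //; apply: asympD => //; apply: asympZ; exact: asymp_invpow.
apply/cvgr0Pnorm_lt => e e0.
pose e' := e * c / 2; have e'0 : 0 < e' by rewrite divr_gt0// mulr_gt0.
have hu0 : asymp a (u \+ (fun n => - U * invpow R a n)) 0.
  by have := asympD hu (asympZ (c := - U) (asymp_invpow a0)); rewrite mulr1 subrr.
have /cvgr0Pnorm_lt/(_ _ e'0)[N _ hN] := hu0.
pose C := `|D N| / invpow R 3 N.
have C0 : 0 <= C by rewrite divr_ge0// invpow_ge0.
have key n : (N <= n)%N -> `|D n| <= e' * (c^-1 * invpow R a n) + C * invpow R 3 n.
  move=> Nn; rewrite -(subnKC Nn); elim: (n - N)%N => [|m ih].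
    rewrite addn0 /C divfK ?invpow_neq0// lerDr mulr_ge0 ?ltW// mulr_gt0 ?invr_gt0//.
    exact: invpow_gt0.
  rewrite addnS SS; set k := (N + m)%N in ih *.
  have i0 : 0 < (2 * k.+1)%N%:R^-1 :> R by rewrite invr_gt0 ltr0n.
  apply: le_trans (ler_normD _ _) _; rewrite !normrM.
  have i1 : 0 <= 1 + (2 * k.+1)%N%:R^-1 :> R by rewrite addr_ge0// ltW.
  rewrite (gtr0_norm i0) (ger0_norm i1).
  have -> : e' * (c^-1 * invpow R a k.+1) + C * invpow R 3 k.+1 =
      (e' * (c^-1 * invpow R a k) + C * invpow R 3 k) * (1 + (2 * k.+1)%:R^-1) +
      e' * invpow R a k / (2 * k.+1)%:R by rewrite gaS g3S; ring.
  apply: lerD; first by rewrite ler_wpM2r.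
  rewrite ler_wpM2r ?ltW//; have := hN k (leq_addr _ _).
  rewrite /= mulNr normrM normfV (gtr0_norm (invpow_gt0 R k a0)).
  by rewrite ltr_pdivrMr ?invpow_gt0.
have /cvgr0Pnorm_lt : asymp a (fun n => C * invpow R 3 n) 0.
  have -> : 0 = C * 0 :> R by rewrite mulr0.
  by apply: asympZ; apply: invpow_lower; rewrite a3.
move=> /(_ (e / 2)); rewrite divr_gt0// => /(_ isT)[M _ hM].
near=> n.
have g0 := invpow_gt0 R n a0.
have Nn : (N <= n)%N by near: n; exact: nbhs_infty_ge.
have Mn : (M <= n)%N by near: n; exact: nbhs_infty_ge.
rewrite normrM normfV (gtr0_norm g0) ltr_pdivrMr//.
apply: le_lt_trans (key _ Nn) _.
have /= := hM _ Mn; rewrite normrM normfV (gtr0_norm g0) ltr_pdivrMr//.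
rewrite ger0_norm; last by apply: mulr_ge0; rewrite // invpow_ge0.
move=> hC.
have -> : e' * (c^-1 * invpow R a n) = e / 2 * invpow R a n.
  by rewrite /e'; field; rewrite gt_eqF.
have -> : e * invpow R a n = e / 2 * invpow R a n + e / 2 * invpow R a n by field.
by rewrite ltrD2l.
Unshelve. all: by end_near. Qed.

End Regular.
(** * The chain of outdegrees and its generating functions *)

Section OutdegreeChain.

(** One step of the growth, as an operator on functions of the list of
    outdegrees.  Applied to the values of [f], it sums over all places. *)
Definition grow (V : nmodType) (f : seq nat -> V) (d : seq nat) : V :=
  \sum_(v < size d) f (rcons (incr_nth d v) 0%N) *+ (nth 0%N d v).+1.

Lemma grow_morph (U V : nmodType) (L : {additive U -> V}) (f : seq nat -> U) n d :
  L (iter n (@grow U) f d) = iter n (@grow V) (L \o f) d.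
Proof.
elim: n d => [//|n ih] d; rewrite !iterS /grow raddf_sum.
by apply: eq_bigr => v _; rewrite raddfMn ih.
Qed.

Lemma eq_grow (V : nmodType) (f g : seq nat -> V) n a l :
  (forall a l, f (a :: l) = g (a :: l)) ->
  iter n (@grow V) f (a :: l) = iter n (@grow V) g (a :: l).
Proof.
move=> fg; elim: n a l => [|n ih] a l; first exact: fg.
by rewrite !iterS; apply: eq_bigr => -[[|v] vs] _ /=; rewrite ih.
Qed.

End OutdegreeChain.

Section GeneratingFunction.
Variable R : realType.
Local Notation K := {poly R}.
Implicit Types chi : bool -> nat -> K.

Lemma natpoly_neq0 n : n.+1%:R != 0 :> K.
Proof. by rewrite -polyC_natr polyC_eq0 pnatr_eq0. Qed.

Lemma dseq_inj (x y : nat -> K) n : dseq x n = dseq y n -> x n.+1 = y n.+1.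
Proof. by move=> /mulfI; apply; rewrite mulnS add2n natpoly_neq0. Qed.

(** The recursion for the coefficient of index n uses all lower ones, at other
    nodes; the table holds those up to [n]. *)
Fixpoint nodegf_table chi (n : nat) : nat -> bool -> nat -> K :=
  if n is n'.+1 then
    fun i b m => if (i <= n')%N then nodegf_table chi n' i b m else
      (m.+1%:R / (2 * n'.+1)%:R) *:
        \sum_(j < n'.+1) nodegf_table chi n' j b m.+1 * nodegf_table chi n' (n' - j) false 0%N
  else fun _ b m => chi b m.

(** Coefficients of the generating function of everything that grows from one
    node with [m] children.  The weight of a node with j children is
    [chi true j] for the root and [chi false j] for the others; [b] says which of
    the two applies to the initial node. *)
Definition nodegf chi b m (n : nat) : K := nodegf_table chi n n b m.

Lemma nodegf_tableE chi n i b m : (i <= n)%N -> nodegf_table chi n i b m = nodegf chi b m i.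
Proof.
elim: n => [|n ih]; first by rewrite leqn0 => /eqP ->.
by rewrite leq_eqVlt ltnS => /predU1P[->//|ni]; rewrite /= ni ih.
Qed.

Lemma nodegf0 chi b m : nodegf chi b m 0 = chi b m. Proof. by []. Qed.

Lemma dseq_nodegf chi b m :
  dseq (nodegf chi b m) = fun n => m.+1%:R * conv (nodegf chi b m.+1) (nodegf chi false 0) n.
Proof.
apply/funext => n; rewrite /dseq {1}/nodegf /= ltnn -!mul_polyC mulrA -!polyC_natr.
rewrite -polyCM mulrCA divff ?pnatr_eq0// mulr1; congr (_ * _).
by apply: eq_bigr => j _; rewrite !nodegf_tableE ?leq_subr// -ltnS.
Qed.

(** The equation determines the coefficient of index n + 1 of each unknown from
    those of index at most n of its successor. *)
Lemma ode_unique (B : nat -> K) (x y : nat -> nat -> K) :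
  (forall m, x m 0 = y m 0) ->
  (forall m, dseq (x m) = fun n => m.+1%:R * conv (x m.+1) B n) ->
  (forall m, dseq (y m) = fun n => m.+1%:R * conv (y m.+1) B n) -> x = y.
Proof.
move=> xy0 dx dy; suff h n : forall m i, (i <= n)%N -> x m i = y m i.
  by apply/funext => m; apply/funext => n; exact: (h n).
elim: n => [|n ih] m i; first by rewrite leqn0 => /eqP ->.
rewrite leq_eqVlt => /predU1P[->|]; last exact: ih.
apply: dseq_inj; rewrite dx dy; congr (_ * _).
by apply: eq_bigr => j _; rewrite ih// -ltnS.
Qed.

Lemma eq_nodegf chi chi' b b' m : chi b =1 chi' b' -> chi false =1 chi' false ->
  nodegf chi b m = nodegf chi' b' m.
Proof.
move=> eb e; apply/funext => n; rewrite /nodegf.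
have h k i j : nodegf_table chi k i false j = nodegf_table chi' k i false j.
  elim: k i j => [|k ih] i j /=; first exact: e.
  by case: ifP => _; rewrite ?ih//; congr (_ *: _); apply: eq_bigr => u _; rewrite !ih.
suff hb k i j : nodegf_table chi k i b j = nodegf_table chi' k i b' j by exact: hb.
elim: k i j => [|k ih] i j /=; first exact: eb.
by case: ifP => _; rewrite ?ih//; congr (_ *: _); apply: eq_bigr => u _; rewrite ih h.
Qed.

Definition forestgf chi (l : seq nat) : nat -> K :=
  foldr (fun m => conv (nodegf chi false m)) delta l.

Definition stategf chi a l := conv (nodegf chi true a) (forestgf chi l).

Lemma forestgf_rcons chi l :
  forestgf chi (rcons l 0%N) = conv (forestgf chi l) (nodegf chi false 0).
Proof.
elim: l => [|m l ih] /=; first by rewrite conv_delta convC conv_delta.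
by rewrite ih convA.
Qed.

Lemma conv_dseq_nodegf chi b m x :
  conv (dseq (nodegf chi b m)) x =
  fun n => conv (nodegf chi b m.+1) (conv x (nodegf chi false 0)) n *+ m.+1.
Proof.
rewrite dseq_nodegf convZl -convA (convC (nodegf _ _ _) x).
by apply/funext => n; rewrite mulr_natl.
Qed.

Lemma dseq_delta : dseq delta = fun=> 0 :> K.
Proof. by apply/funext => n; rewrite /dseq /delta mulr0. Qed.

Lemma dseq_forestgf chi l : dseq (forestgf chi l) =
  fun n => \sum_(v < size l) forestgf chi (rcons (incr_nth l v) 0%N) n *+ (nth 0%N l v).+1.
Proof.
elim: l => [|m l ih] /=.
  by rewrite dseq_delta; apply/funext => n; rewrite big_ord0.
rewrite dseq_conv ih conv_dseq_nodegf conv_sumr.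
apply/funext => n /=; rewrite big_ord_recl/= forestgf_rcons; congr (_ + _).
by apply: eq_bigr => v _ /=; rewrite convMnr.
Qed.

Definition stateweight chi (d : seq nat) : K :=
  chi true (head 0%N d) * \prod_(m <- behead d) chi false m.

Lemma forestgf0 chi l : forestgf chi l 0 = \prod_(m <- l) chi false m.
Proof.
elim: l => [|m l ih]; first by rewrite big_nil.
by rewrite big_cons /= /conv big_ord1/= ih nodegf0.
Qed.

(** The growth operator is the derivation that raises one factor of the product
    at a time, so its iterates are the derivatives of the product. *)
Lemma iter_grow_weight chi n a l :
  iter n (@grow K) (stateweight chi) (a :: l) = stategf chi a l n *+ (2 ^ n * n`!).
Proof.
elim: n a l => [|n ih] a l.
  by rewrite /= /stategf /conv big_ord1 nodegf0 forestgf0.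
have -> : stategf chi a l n.+1 *+ (2 ^ n.+1 * n.+1`!) =
    dseq (stategf chi a l) n *+ (2 ^ n * n`!).
  by rewrite /dseq mulr_natl -mulrnA factS expnS; congr (_ *+ _); lia.
rewrite iterS {1}/stategf dseq_conv conv_dseq_nodegf dseq_forestgf conv_sumr/=.
rewrite /grow big_ord_recl/= ih mulrnDl /stategf forestgf_rcons mulrnAC; congr (_ + _).
rewrite -sumrMnl; apply: eq_bigr => v _ /=; rewrite ih /stategf mulrnAC.
by rewrite convMnr.
Qed.

(** The weights seen by a root that has one further child. *)
Definition raise_root chi b m := if b then chi b m.+1 else chi b m.

(** The antiderivative, in the normalization of [dseq]. *)
Definition prim (x : nat -> K) (n : nat) : K :=
  if n is j.+1 then (2 * j.+1)%:R^-1 *: x j else 0.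

Lemma dseq_prim x : dseq (prim x) = x.
Proof.
apply/funext => n; rewrite /dseq /= -mul_polyC -polyC_natr mulrA -polyCM.
by rewrite divff ?pnatr_eq0// mul1r.
Qed.

(** The family h_m of root factors and the family
    y_m = h'_(m-1) + Q h'_m solve the same system, where primes mark the raised
    weights, h'_(-1) is constant, and Q is the generating function of the leftmost
    subtree.  This extends the decomposition, the case m = 0, to all m. *)
Lemma nodegf_leftmost chi : nodegf chi true 0 =
  (fun n => chi true 0 * delta n) \+
  conv (prim (nodegf chi false 0)) (nodegf (raise_root chi) true 0).
Proof.
pose B := nodegf chi false 0; pose Q := prim B.
have BE : nodegf (raise_root chi) false 0 = B by exact: eq_nodegf.
pose k m := nodegf (raise_root chi) true m.
pose y m := (if m is m'.+1 then k m' else fun n => chi true 0 * delta n) \+ conv Q (k m).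
suff -> : nodegf chi true = y by [].
apply: (@ode_unique B).
- by move=> [|m]; rewrite nodegf0 /y/= /conv big_ord1 /= mul0r addr0 ?mulr1 ?nodegf0.
- by move=> m; rewrite dseq_nodegf.
have dD u v : dseq (u \+ v) = dseq u \+ dseq v :> (nat -> K).
  by apply/funext => n; rewrite /dseq/= mulrDr.
have dk m : dseq (k m) = fun n => m.+1%:R * conv (k m.+1) B n by rewrite dseq_nodegf BE.
move=> m; rewrite dD dseq_conv dseq_prim dk convZr.
have -> : dseq (if m is m'.+1 then k m' else fun n => chi true 0 * delta n) =
    fun n => m%:R * conv (k m) B n.
  case: m => [|m]; last exact: dk.
  by apply/funext => n; rewrite /dseq /delta/= !mulr0 mul0r.
rewrite /y/= convDl; apply/funext => n /=; rewrite -convA (convC B (k m)).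
by rewrite -natr1; ring.
Qed.

End GeneratingFunction.
(** * Moments of the Zagreb index and the root degree *)

Section Moments.
Variable R : realType.
Local Notation K := {poly R}.

(** The operator x d/dx. *)
Definition theta (p : K) : K := 'X * p^`().

Fact theta_linear : linear theta.
Proof. by move=> c p q; rewrite /theta derivD derivZ mulrDr scalerAr. Qed.

HB.instance Definition _ := GRing.isLinear.Build R K K _ theta theta_linear.

Lemma thetaM p q : theta (p * q) = theta p * q + p * theta q.
Proof. by rewrite /theta derivM; ring. Qed.

Lemma iter_thetaM r p q : iter r theta (p * q) =
  \sum_(l < r.+1) (iter l theta p * iter (r - l) theta q) *+ 'C(r, l).
Proof.
elim: r => [|r ih]; first by rewrite big_ord1 /= bin0.
rewrite iterS ih linear_sum/=.
have -> : \sum_(l < r.+1) theta ((iter l theta p * iter (r - l) theta q) *+ 'C(r, l)) =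
    \sum_(l < r.+1) (iter l.+1 theta p * iter (r - l) theta q) *+ 'C(r, l) +
    \sum_(l < r.+1) (iter l theta p * iter (r.+1 - l) theta q) *+ 'C(r, l).
  rewrite -big_split; apply: eq_bigr => l _ /=.
  have lr : (l <= r)%N by rewrite -ltnS.
  by rewrite raddfMn/= thetaM mulrnDl subSn.
rewrite [in RHS]big_ord_recl/= bin0.
under [in RHS]eq_bigr => l _ do rewrite /bump/= add1n binS mulrnDr subSS.
rewrite big_split/= addrA addrC; congr (_ + _).
rewrite big_ord_recl/= bin0; congr (_ + _).
by rewrite big_ord_recr/= bin_small// mulr0n addr0.
Qed.

(** Sends a generating polynomial sum_z c_z x^z to its moment sum_z c_z z^r. *)
Definition mom (r : nat) (p : K) : R := (iter r theta p).[1].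

Fact mom_linear r : linear_for *%R (mom r).
Proof.
move=> c p q; rewrite /mom.
have -> : iter r theta (c *: p + q) = c *: iter r theta p + iter r theta q.
  by elim: r => [//|r ih]; rewrite !iterS ih linearP.
by rewrite hornerD hornerZ.
Qed.

HB.instance Definition _ r := GRing.isLinear.Build R K R _ (mom r) (mom_linear r).

Lemma momM r p q :
  mom r (p * q) = \sum_(l < r.+1) 'C(r, l)%:R * (mom l p * mom (r - l) q).
Proof.
rewrite /mom iter_thetaM horner_sum; apply: eq_bigr => l _.
by rewrite hornerMn hornerM mulr_natl.
Qed.

Lemma mom_monomial r (c : R) z : mom r (c *: 'X^z) = c * z%:R ^+ r.
Proof.
rewrite /mom; have -> : iter r theta (c *: 'X^z) = (c * z%:R ^+ r) *: 'X^z.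
  elim: r => [|r ih]; first by rewrite expr0 mulr1.
  rewrite iterS ih linearZ/= /theta derivXn exprSr mulrA -[in RHS]scalerA; congr (_ *: _).
  by case: z {ih} => [|z]; rewrite ?scale0r ?mulr0n ?mulr0// mulrnAr -exprS scaler_nat.
by rewrite hornerZ hornerXn expr1n mulr1.
Qed.

Lemma mom_conv r (x y : nat -> K) n : mom r (conv x y n) =
  \sum_(l < r.+1) 'C(r, l)%:R * conv (mom l \o x) (mom (r - l) \o y) n.
Proof.
rewrite /conv linear_sum/=; under eq_bigr do rewrite momM.
rewrite exchange_big/=; apply: eq_bigr => l _.
by rewrite big_distrr.
Qed.

End Moments.

Section Recursion.
Variables (R : realType) (k : nat).

(** What a tree contributes to the index of a larger tree in which its root has a
    parent; without that parent its degree is one less, whence [zag]. *)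
Definition zagsub (d : seq nat) : nat := \sum_(m <- d) m.+1 ^ k.
Definition zag (d : seq nat) : nat := head 0%N d ^ k + zagsub (behead d).

(** 2^n n! is the normalization for which the histories have total weight
    [invpow 1] ([wsum1]). *)
Definition wsum (f : seq nat -> R) (n : nat) : R :=
  iter n (@grow R) f [:: 0%N] / (2 ^ n * n`!)%:R.

Definition zagreb_weight (c : nat -> R) (b : bool) (m : nat) : {poly R} :=
  if b then c m *: 'X^(m ^ k) else 'X^(m.+1 ^ k).

Lemma prod_X (l : seq nat) : \prod_(m <- l) 'X^(m.+1 ^ k) = 'X^(zagsub l) :> {poly R}.
Proof. by rewrite /zagsub; elim/big_ind2: _ => // [? ? ? ? -> ->]; rewrite exprD. Qed.

Lemma wsum_nodegf chi r (f : seq nat -> R) :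
  (forall a l, f (a :: l) = mom r (stateweight chi (a :: l))) ->
  wsum f = mom r \o nodegf chi true 0.
Proof.
move=> fE; apply/funext => n; rewrite /wsum /=.
rewrite (@eq_grow _ f (mom r \o stateweight chi))//.
rewrite -(grow_morph (mom r)) iter_grow_weight raddfMn/=.
rewrite -[X in X / _]mulr_natr mulfK.
  by rewrite /stategf convC conv_delta.
by rewrite pnatr_eq0 muln_eq0 expn_eq0/= -lt0n fact_gt0.
Qed.

(** The antiderivative of a real sequence, in the normalization of [dseq]. *)
Definition primR (x : nat -> R) (n : nat) : R := shift x n / (2 * n)%:R.

Lemma wsum_leftmost r (c : nat -> R) :
  wsum (fun d => (zag d)%:R ^+ r * c (head 0%N d)) =
  (fun n => c 0%N * (0 ^ k)%:R ^+ r * delta n) \+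
  (fun n => \sum_(l < r.+1) 'C(r, l)%:R *
     conv (primR (wsum (fun d => (zagsub d)%:R ^+ l)))
          (wsum (fun d => (zagsub d)%:R ^+ (r - l) * c (head 0%N d).+1)) n).
Proof.
rewrite (@wsum_nodegf (zagreb_weight c) r); last first.
  by move=> a l; rewrite /stateweight/= prod_X -scalerAl -exprD mom_monomial mulrC.
rewrite nodegf_leftmost; apply/funext => n /=; rewrite raddfD/=; congr (_ + _).
  rewrite -mom_monomial /delta; case: n => [|n] /=; rewrite ?mulr1 ?mulr0//.
  by rewrite raddf0.
rewrite mom_conv; apply: eq_bigr => l _; congr (_ * conv _ _ _).
  have -> : nodegf (zagreb_weight c) false 0 = nodegf (fun _ m => 'X^(m.+1 ^ k)) true 0.
    exact: eq_nodegf.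
  rewrite (@wsum_nodegf (fun _ m => 'X^(m.+1 ^ k)) l); last first.
    move=> a s; rewrite /stateweight/= prod_X -exprD -[X in mom _ X]scale1r mom_monomial mul1r.
    by rewrite /zagsub big_cons.
  apply/funext => -[|j]; rewrite /primR/= ?raddf0 ?mul0r//.
  by rewrite linearZ/= mulrC.
rewrite (@wsum_nodegf (raise_root (zagreb_weight c)) (r - l))// => a s.
rewrite /stateweight/= prod_X -scalerAl -exprD mom_monomial mulrC.
by rewrite /zagsub big_cons.
Qed.

End Recursion.
Section Averages.
Variable R : realType.

Lemma eq_wsum (f g : seq nat -> R) :
  (forall a l, f (a :: l) = g (a :: l)) -> wsum f = wsum g.
Proof. by move=> fg; apply/funext => n; rewrite /wsum (eq_grow _ _ _ fg). Qed.

Lemma growD (f g : seq nat -> R) n d : iter n (@grow R) (f \+ g) d =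
  iter n (@grow R) f d + iter n (@grow R) g d.
Proof.
elim: n d => [//|n ih] d; rewrite !iterS /grow -big_split/=.
by apply: eq_bigr => v _; rewrite ih mulrnDl.
Qed.

Lemma growZ (c : R) (f : seq nat -> R) n d :
  iter n (@grow R) (fun e => c * f e) d = c * iter n (@grow R) f d.
Proof.
elim: n d => [//|n ih] d; rewrite !iterS /grow mulr_sumr.
by apply: eq_bigr => v _; rewrite ih mulrnAr.
Qed.

Lemma wsum_sum m (c : nat -> R) (f : nat -> seq nat -> R) n :
  wsum (fun d => \sum_(i < m) c i * f i d) n = \sum_(i < m) c i * wsum (f i) n.
Proof.
elim: m => [|m ih].
  rewrite big_ord0 /wsum.
  have -> : (fun d => \sum_(i < 0) c i * f i d) = (fun d => 0 * f 0%N d).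
    by apply/funext => d; rewrite big_ord0 mul0r.
  by rewrite growZ !mul0r.
rewrite big_ord_recr/= -ih /wsum mulrA -growZ -mulrDl -growD; congr (_ / _).
by congr (iter _ _ _ _); apply/funext => d; rewrite big_ord_recr.
Qed.

(** The number of places is the length plus the sum of the list; a step raises it
    by 2. *)
Lemma iter_grow1 n d :
  iter n (@grow R) (fun=> 1) d = \prod_(i < n) (sumn d + size d + 2 * i)%:R.
Proof.
elim: n d => [|n ih] d; first by rewrite big_ord0.
have w d' : grow (fun=> 1 : R) d' = (sumn d' + size d')%:R.
  rewrite /grow; elim: d' => [|a l ih']; first by rewrite big_ord0.
  by rewrite big_ord_recl ih' -natrD; congr _%:R => /=; lia.
have nxt v : (v < size d)%N -> let d' := rcons (incr_nth d v) 0%N in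
    (sumn d' + size d' = sumn d + size d + 2)%N.
  move=> vd /=; rewrite size_rcons size_incr_nth vd sumn_rcons addn0.
  by elim: d v vd {w} => [//|a l ih'] [|v] /= vd; [lia|have := ih' v vd; lia].
rewrite iterS {1}/grow big_ord_recl muln0 addn0 -w {2}/grow mulr_suml.
apply: eq_bigr => v _; rewrite ih mulrnAl mul1r; congr (_ *+ _).
apply: eq_bigr => i _; rewrite nxt// lift0; congr _%:R; lia.
Qed.

Lemma wsum1 : wsum (fun=> 1) = invpow R 1.
Proof.
apply/funext => n; rewrite /wsum iter_grow1/= addn0 add0n.
elim: n => [|n ih]; first by rewrite big_ord0 invpow0 divr1.
rewrite big_ord_recr/= invpowS -ih factS expnS natrD !natrM.
have h1 : (2 ^ n)%:R != 0 :> R by rewrite pnatr_eq0 expn_eq0.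
have h2 : n`!%:R != 0 :> R by rewrite pnatr_eq0 -lt0n fact_gt0.
move: ((2 ^ n)%:R : R) (n`!%:R : R) h1 h2 => u v u0 v0.
by field; rewrite u0 v0 nat1r pnatr_eq0.
Qed.

End Averages.

Section MomentAsymptotics.
Variables (R : realType) (k : nat).
Hypothesis k3 : (3 <= k)%N.
Local Notation zag := (zag k).
Local Notation zagsub := (zagsub k).

Definition pmom r s := wsum (fun d => (zag d)%:R ^+ r * (head 0%N d)%:R ^+ s : R).
(** The same moments once the root has a parent (for the index) and a further
    child (for its degree). *)
Definition raisedmom r s :=
  wsum (fun d => (zagsub d)%:R ^+ r * (head 0%N d).+1%:R ^+ s : R).
Definition polymom r (f : {poly R}) :=
  wsum (fun d => (zag d)%:R ^+ r * f.[(head 0%N d)%:R] : R).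

Lemma polymomE r (f : {poly R}) d n : (size f <= d)%N ->
  polymom r f n = \sum_(j < d) f`_j * pmom r j n.
Proof.
move=> fd.
rewrite -(wsum_sum _ (fun j => f`_j) (fun j e => (zag e)%:R ^+ r * (head 0%N e)%:R ^+ j)).
congr (_ n); apply: eq_wsum => a l.
rewrite (horner_coef_wide _ fd) mulr_sumr; apply: eq_bigr => j _.
by rewrite mulrCA.
Qed.

Lemma pmom00 : pmom 0 0 = invpow R 1.
Proof. by rewrite -wsum1; apply: eq_wsum => a l; rewrite mulr1. Qed.

Lemma raisedmom00 : raisedmom 0 0 = invpow R 1.
Proof. by rewrite -wsum1; apply: eq_wsum => a l; rewrite mulr1. Qed.

Lemma pmom_rec r s : pmom r s =
  (fun n => 0 ^+ s * 0 ^+ r * delta n) \+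
  (fun n => \sum_(0 <= l < r.+1)
     'C(r, l)%:R * conv (primR (raisedmom l 0)) (raisedmom (r - l) s) n).
Proof.
rewrite /pmom (@wsum_leftmost R k r (fun m => m%:R ^+ s)) exp0n; last by lia.
congr (_ \+ _); apply/funext => n; rewrite big_mkord; apply: eq_bigr => l _.
congr (_ * conv _ _ _); congr (primR _).
by apply: eq_wsum => a d; rewrite expr0 mulr1.
Qed.

Lemma invpow1_rec : invpow R 1 = delta \+ conv (primR (invpow R 1)) (invpow R 1).
Proof.
rewrite -[LHS]pmom00 pmom_rec; apply/funext => n /=.
by rewrite big_nat1 bin0 !mul1r raisedmom00.
Qed.

(** With Q for [primR (invpow 1)], the recursion for r = s = 0 says that 1 - Q is
    the inverse of the generating function of [invpow 1]. *)
Lemma invpow1_solve (y z : nat -> R) :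
  y = z \+ conv (primR (invpow R 1)) y -> y = conv (invpow R 1) z.
Proof.
move=> yz; set Q := primR _ in yz.
have : conv (invpow R 1) y = conv (invpow R 1) z \+ conv (invpow R 1) (conv Q y).
  by rewrite {1}yz convDr.
rewrite {1}invpow1_rec convDl conv_delta convA (convC (invpow R 1) Q).
move=> /(congr1 (fun f n => f n - conv (conv Q (invpow R 1)) y n)) h.
apply/funext => n; have := congr1 (@^~ n) h.
by rewrite /= !addrK.
Qed.

Definition excessmom r s n := raisedmom r s n - pmom r s n.

(** The term l = 0 of the recursion is the product of Q and
    [raisedmom r s = pmom r s + excessmom r s]; the product of Q, [invpow 1] and
    the excess is [invpow 1] times the excess minus the excess. *)
Lemma pmom_solve r s : (0 < r + s)%N -> pmom r s =
  (conv (invpow R 1) (excessmom r s) \+ (fun n => - excessmom r s n)) \+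
  conv (invpow R 1) (fun n => \sum_(1 <= l < r.+1)
     'C(r, l)%:R * conv (primR (raisedmom l 0)) (raisedmom (r - l) s) n).
Proof.
move=> rs; set S := fun n => \sum_(1 <= l < r.+1) _.
set Q := primR (invpow R 1).
have E : pmom r s = (conv Q (excessmom r s) \+ S) \+ conv Q (pmom r s).
  rewrite {1}pmom_rec; apply/funext => n /=; rewrite -exprD expr0n addn_eq0.
  have -> : (s == 0%N) && (r == 0%N) = false by lia.
  rewrite mul0r add0r big_ltn// bin0 mul1r subn0 raisedmom00 -/Q -/(S n).
  have -> : raisedmom r s = excessmom r s \+ pmom r s.
    by apply/funext => i; rewrite /excessmom/= subrK.
  by rewrite convDr/= addrAC.
rewrite {1}(invpow1_solve E) convDr; congr (_ \+ _).
rewrite convA (convC _ Q); apply/funext => n /=.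
have -> : conv Q (invpow R 1) = invpow R 1 \+ (fun n => - 1 * delta n).
  by apply/funext => i; rewrite {2}invpow1_rec /= -/Q mulN1r addrAC subrr add0r.
by rewrite convDl convZl conv_delta/= mulN1r.
Qed.

(** Increment of the s-th power; for s = k, evaluated at the root degree, it is
    the change of the index. *)
Definition dpoly s : {poly R} := ('X + 1) ^+ s - 'X^s.

Lemma dpolyE s : dpoly s = \poly_(j < s) 'C(s, j)%:R.
Proof.
rewrite /dpoly exprD1n big_ord_recr/= binn mulr1n addrK poly_def.
by apply: eq_bigr => j _; rewrite scaler_nat.
Qed.

Lemma horner_dpoly s (x : R) : (dpoly s).[x] = (x + 1) ^+ s - x ^+ s.
Proof. by rewrite /dpoly !hornerE. Qed.

Lemma excessmomE r s n : excessmom r s n = polymom r (dpoly s) n +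
  \sum_(1 <= i < r.+1) 'C(r, i)%:R * polymom (r - i) (dpoly k ^+ i * ('X + 1) ^+ s) n.
Proof.
have -> : \sum_(1 <= i < r.+1) 'C(r, i)%:R * polymom (r - i) (dpoly k ^+ i * ('X + 1) ^+ s) n =
  \sum_(i < r) 'C(r, i.+1)%:R * polymom (r - i.+1) (dpoly k ^+ i.+1 * ('X + 1) ^+ s) n.
  by rewrite big_add1/= big_mkord.
rewrite -(wsum_sum _ (fun i => 'C(r, i.+1)%:R)
  (fun i d => (zag d)%:R ^+ (r - i.+1) * (dpoly k ^+ i.+1 * ('X + 1) ^+ s).[(head 0%N d)%:R])).
rewrite /excessmom /raisedmom /pmom /polymom /wsum -mulrBl -mulrDl; congr (_ / _).
rewrite -growD -[X in _ - X]mul1r -mulNr -growZ -growD; apply: eq_grow => a l.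
rewrite /= mulN1r /zagsub big_cons -/(zagsub l) /zag/= -/(zagsub l).
set z := zagsub l; set x : R := a%:R.
have -> : (a.+1 ^ k + z)%:R = (a ^ k + z)%:R + (dpoly k).[x] :> R.
  by rewrite horner_dpoly !natrD !natrX -(natr1 a); ring.
rewrite exprDn big_ord_recl/= subn0 bin0 expr0 mulr1 mulr1n mulrDl mulr_suml.
rewrite addrAC; congr (_ + _).
  by rewrite horner_dpoly -(natr1 a); ring.
apply: eq_bigr => i _; rewrite /bump/= add1n hornerM !horner_exp !hornerE.
rewrite /= -[X in X * _ = _]mulr_natl -(natr1 a); ring.
Qed.

(** Defined as a limit, whose existence is the content of [regular_all]. *)
Definition momcst r s : R := lim (pmom r s n / invpow R (k * r + s + 1) n @[n --> \oo]).

Definition regular r s := asymp (k * r + s + 1) (pmom r s) (momcst r s).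

Lemma regularP r s B : asymp (k * r + s + 1) (pmom r s) B ->
  regular r s /\ momcst r s = B.
Proof.
move=> h; have E : momcst r s = B by apply: cvg_lim => //; exact: h.
by rewrite /regular E.
Qed.

Lemma asymp_polymom r d (f : {poly R}) : (size f <= d.+1)%N ->
  (forall j, (j <= d)%N -> regular r j) ->
  asymp (k * r + d + 1) (polymom r f) (f`_d * momcst r d).
Proof.
move=> fd reg.
have -> : polymom r f = (fun n => \sum_(j < d) f`_j * pmom r j n) \+
    (fun n => f`_d * pmom r d n).
  by apply/funext => n; rewrite (polymomE _ _ fd) big_ord_recr.
rewrite -[X in asymp _ _ X]add0r; apply: asympD; last by apply: asympZ; exact: reg.
have E : \sum_(j < d) f`_j * 0 = 0 :> R by rewrite big1// => j _; rewrite mulr0.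
rewrite -[X in asymp _ _ X]E; apply: asymp_sum => j _ _; apply: asympZ.
apply: (@asymp_lower _ _ (k * r + j + 1) _ (momcst r j)); first by have := ltn_ord j; lia.
by apply: reg; exact: ltnW.
Qed.

Lemma coefM_top (p q : {poly R}) a b : (size p <= a.+1)%N -> (size q <= b.+1)%N ->
  (p * q)`_(a + b) = p`_a * q`_b.
Proof.
move=> pa qb; rewrite coefM (bigD1 (inord a)) //= inordK ?ltnS ?leq_addr//.
rewrite addKn big1 ?addr0// => i.
rewrite -val_eqE /= inordK ?ltnS ?leq_addr// neq_ltn => /orP[ia|ai].
  by rewrite [X in _ * X]nth_default ?mulr0//; apply: leq_trans qb _; lia.
by rewrite nth_default ?mul0r//; exact: leq_trans pa _.
Qed.

Lemma size_dpoly s : (size (dpoly s) <= s)%N.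
Proof. by rewrite dpolyE size_poly. Qed.

Lemma size_X1_exp s : (size (('X + 1) ^+ s : {poly R})%R <= s.+1)%N.
Proof.
by apply: leq_trans (size_poly_exp_leq _ _) _; rewrite size_XaddC mul1n.
Qed.

Lemma size_dpoly_exp i s :
  (size (dpoly k ^+ i * ('X + 1) ^+ s)%R <= (i * (k - 1) + s).+1)%N.
Proof.
apply: leq_trans (size_polyMleq _ _) _.
have h1 := size_poly_exp_leq (dpoly k) i; have h2 := size_X1_exp s.
have h3 : ((size (dpoly k)).-1 * i <= i * (k - 1))%N.
  by rewrite mulnC leq_mul2l; apply/orP; right; have := size_dpoly k; lia.
lia.
Qed.

Lemma coef_dpoly_exp1 s : (dpoly k ^+ 1 * ('X + 1) ^+ s)`_(k + s - 1) = k%:R.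
Proof.
have -> : (k + s - 1 = k.-1 + s)%N by lia.
rewrite expr1 coefM_top ?size_X1_exp//; last first.
  by apply: leq_trans (size_dpoly k) _; lia.
have -> : (('X + 1) ^+ s : {poly R})`_s = 1.
  by rewrite -[_ ^+ s](subrK 'X^s) -/(dpoly s) coefD coefXn eqxx dpolyE coef_poly ltnn add0r.
rewrite dpolyE coef_poly mulr1; have -> : (k.-1 < k)%N by lia.
by rewrite -subn1 bin_sub ?bin1//; lia.
Qed.

(** Replacing i of the r factors Z by the increment, a polynomial of degree k - 1
    in the root degree, lowers the order kr + s + 1 by i; dropping one root
    factor lowers it by one.  Only the terms of order kr + s remain. *)
Lemma asymp_excessmom r s : (0 < r + s)%N ->
  (forall r' s', (r' < r)%N -> regular r' s') ->
  (forall s', (s' < s)%N -> regular r s') ->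
  asymp (k * r + s) (excessmom r s)
    ((k * r)%:R * momcst (r - 1) (k + s - 1) + s%:R * momcst r (s - 1)).
Proof.
move=> rs regr regs.
have -> : excessmom r s = polymom r (dpoly s) \+ (fun n =>
  \sum_(1 <= i < r.+1) 'C(r, i)%:R * polymom (r - i) (dpoly k ^+ i * ('X + 1) ^+ s) n).
  by apply/funext => n; rewrite excessmomE.
rewrite [X in asymp _ _ X]addrC; apply: asympD.
  case: s regs {rs} => [|s] regs.
    have -> : polymom r (dpoly 0) = fun=> 0.
      apply/funext => n; rewrite (@polymomE r (dpoly 0) 0); first by rewrite big_ord0.
      exact: size_dpoly.
    by rewrite mul0r; exact: asymp_cst0.
  have := @asymp_polymom r s (dpoly s.+1) (size_dpoly _) regs.
  have -> : (dpoly s.+1)`_s = s.+1%:R by rewrite dpolyE coef_poly ltnSn binSn.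
  by rewrite subn1 addn1 addnS.
case: (posnP r) => [r0|r0].
  by rewrite r0 muln0 mul0r; under eq_fun do rewrite big_nil; exact: asymp_cst0.
have -> : (k * r)%:R * momcst (r - 1) (k + s - 1) =
    \sum_(1 <= i < r.+1) (if i == 1%N then (k * r)%:R * momcst (r - 1) (k + s - 1) else 0).
  by rewrite big_ltn// eqxx big_nat_cond big1 ?addr0// => -[|[|i]].
apply: asymp_sum => i; rewrite mem_index_iota => /andP[i1 ir] _; case: eqP => [->|iN1].
  rewrite bin1 natrM (mulrC k%:R) -mulrA; apply: asympZ.
  have := @asymp_polymom (r - 1) (k + s - 1) _ _ (fun j _ => regr _ _ _).
  move=> /(_ (dpoly k ^+ 1 * ('X + 1) ^+ s)); rewrite coef_dpoly_exp1.
  have -> : (k * (r - 1) + (k + s - 1) + 1 = k * r + s)%N by nia.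
  apply; last by lia.
  by apply: leq_trans (size_dpoly_exp _ _) _; lia.
rewrite -[X in asymp _ _ X](mulr0 'C(r, i)%:R); apply: asympZ.
have h := @asymp_polymom (r - i) (i * (k - 1) + s) _ (size_dpoly_exp i s) (fun j _ => regr _ _ _).
apply: asymp_lower (h _); last by lia.
by apply/andP; split; nia.
Qed.

Lemma raisedmomE r s : raisedmom r s = pmom r s \+ excessmom r s.
Proof. by apply/funext => n; rewrite /excessmom/= addrC subrK. Qed.

Lemma asymp_raisedmom r s : (forall r' s', (r' < r)%N -> regular r' s') ->
  (forall s', (s' <= s)%N -> regular r s') ->
  asymp (k * r + s + 1) (raisedmom r s) (momcst r s).
Proof.
move=> regr regs; case: (posnP (r + s)) => [rs|rs].
  have [r0 s0] : r = 0%N /\ s = 0%N by lia.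
  by move: regs; rewrite r0 s0 raisedmom00 -pmom00; exact.
rewrite raisedmomE -[X in asymp _ _ X]addr0; apply: asympD; first exact: regs.
apply: asymp_lower (asymp_excessmom rs regr (fun s' h => regs s' (ltnW h))).
by rewrite addn1 ltnSn; nia.
Qed.

Lemma asymp_primR a (x : nat -> R) (A : R) : (2 < a)%N -> asymp a x A ->
  asymp (a - 2) (primR x) (A / (a - 2)%:R).
Proof. by move=> a2 h; apply: asymp_divn => //; apply: asymp_shift => //; lia. Qed.

(** The subtree has order kl + 1, lowered by 2 by [primR]; the remaining tree has
    order k(r-l) + s + 1, and the solving factor [invpow 1] has order 1. *)
Lemma asymp_split r s l : (0 < l <= r)%N ->
  (forall r' s', (r' < r)%N -> regular r' s') ->
  regular l 0 -> (forall s', (s' <= s)%N -> regular (r - l) s') ->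
  asymp (k * r + s + 1)
    (conv (invpow R 1) (conv (primR (raisedmom l 0)) (raisedmom (r - l) s)))
    (momcst l 0 / (k * l - 1)%:R * momcst (r - l) s).
Proof.
move=> /andP[l0 lr] regr regl regs.
have h1 : asymp (k * l - 1) (primR (raisedmom l 0)) (momcst l 0 / (k * l - 1)%:R).
  have := @asymp_primR (k * l + 0 + 1) _ (momcst l 0).
  have -> : (k * l + 0 + 1 - 2 = k * l - 1)%N by lia.
  apply; first by nia.
  apply: asymp_raisedmom => [r' s' r'l|s']; first by apply: regr; exact: leq_trans lr.
  by rewrite leqn0 => /eqP ->.
have h2 : asymp (k * (r - l) + s + 1) (raisedmom (r - l) s) (momcst (r - l) s).
  by apply: asymp_raisedmom => // r' s' r'l; apply: regr; lia.
have -> : (k * r + s + 1 = 1 + (k * l - 1 + (k * (r - l) + s + 1)))%N by nia.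
rewrite -[X in asymp _ _ X]mul1r; have h3 := @asymp_invpow R 1 isT.
by apply: (asymp_conv _ _ h3 (asymp_conv _ _ h1 h2)); nia.
Qed.

Lemma asymp_mainterm r s : (0 < r + s)%N ->
  (forall r' s', (r' < r)%N -> regular r' s') ->
  (forall s', (s' < s)%N -> regular r s') ->
  asymp (k * r + s + 1) (conv (invpow R 1) (excessmom r s) \+ (fun n => - excessmom r s n))
    ((k * r)%:R * momcst (r - 1) (k + s - 1) + s%:R * momcst r (s - 1)).
Proof.
move=> rs regr regs; have h := asymp_excessmom rs regr regs.
have krs : (0 < k * r + s)%N by nia.
rewrite -[X in asymp _ _ X]addr0; apply: asympD.
  rewrite addn1 -add1n -[X in asymp _ _ X]mul1r; apply: asymp_conv => //.
  exact: asymp_invpow.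
by rewrite -oppr0; apply: asympN; apply: asymp_lower h; rewrite addn1 ltnSn krs.
Qed.

Lemma conv_invpow1_sum (I : Type) (t : seq I) (c : I -> R) (y : I -> nat -> R) :
  conv (invpow R 1) (fun n => \sum_(i <- t) c i * y i n) =
  fun n => \sum_(i <- t) c i * conv (invpow R 1) (y i) n.
Proof.
by rewrite conv_sumr; apply/funext => n; apply: eq_bigr => i _; rewrite convZr.
Qed.

Lemma asymp_pmom_pos r s : (0 < r + s)%N -> (r == 0%N) || (0 < s)%N ->
  (forall r' s', (r' < r)%N -> regular r' s') ->
  (forall s', (s' < s)%N -> regular r s') ->
  asymp (k * r + s + 1) (pmom r s)
    (\sum_(1 <= l < r.+1) 'C(r, l)%:R * (momcst l 0 / (k * l - 1)%:R * momcst (r - l) s) +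
     ((k * r)%:R * momcst (r - 1) (k + s - 1) + s%:R * momcst r (s - 1))).
Proof.
move=> rs rs' regr regs; rewrite (pmom_solve rs) [X in asymp _ _ X]addrC conv_invpow1_sum.
apply: asympD; first exact: asymp_mainterm.
apply: asymp_sum => l; rewrite mem_index_iota => /andP[l1 lr] _; apply: asympZ.
apply: asymp_split => //; first by lia.
  by case: (ltnP l r) => [|rl]; [exact: regr|have -> : l = r by lia]; apply: regs; lia.
by move=> s' _; apply: regr; lia.
Qed.

Lemma conv_primR_invpow2 x n :
  conv (primR x) (invpow R 2) n = \sum_(j < n) x j / (2 * j.+1)%:R.
Proof.
rewrite /conv big_ord_recl /primR/= !mul0r add0r.
by apply: eq_bigr => j _; rewrite invpow2 mulr1.
Qed.

(** The term l = r now involves [pmom r 0] itself.  As [invpow 1] squared is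
    constantly 1, its contribution is the partial sum in [asymp_volterra]; the
    latter applies because k >= 3 makes kr > 2. *)
Lemma asymp_pmom_zero r : (0 < r)%N ->
  (forall r' s', (r' < r)%N -> regular r' s') ->
  asymp (k * r + 0 + 1) (pmom r 0)
    ((\sum_(1 <= l < r) 'C(r, l)%:R * (momcst l 0 / (k * l - 1)%:R * momcst (r - l) 0) +
     (k * r)%:R * momcst (r - 1) (k - 1)) * (k * r - 1)%:R / (k * r - 2)%:R).
Proof.
move=> r0 regr.
pose u := ((conv (invpow R 1) (excessmom r 0) \+ (fun n => - excessmom r 0 n)) \+
   conv (invpow R 1) (fun n => \sum_(1 <= l < r)
     'C(r, l)%:R * conv (primR (raisedmom l 0)) (raisedmom (r - l) 0) n)) \+
   conv (primR (excessmom r 0)) (invpow R 2).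
have r0' : (0 < r + 0)%N by rewrite addn0.
have kr : (3 <= k * r)%N by nia.
have uE n : pmom r 0 n = u n + \sum_(j < n) pmom r 0 j / (2 * j.+1)%:R.
  rewrite {1}(pmom_solve r0') /= /u /= -!addrA; congr (_ + (_ + _)).
  have -> : (fun n => \sum_(1 <= l < r.+1) 'C(r, l)%:R *
      conv (primR (raisedmom l 0)) (raisedmom (r - l) 0) n) =
    (fun n => \sum_(1 <= l < r) 'C(r, l)%:R *
      conv (primR (raisedmom l 0)) (raisedmom (r - l) 0) n) \+
    conv (primR (raisedmom r 0)) (invpow R 1).
    by apply/funext => m; rewrite big_nat_recr//= binn mul1r subnn raisedmom00.
  rewrite convDr/=; congr (_ + _); rewrite convCA conv_invpow -conv_primR_invpow2.
  have -> : primR (raisedmom r 0) = primR (excessmom r 0) \+ primR (pmom r 0).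
    apply/funext => -[|m]; rewrite /primR/= ?mul0r ?addr0//.
    by rewrite raisedmomE -mulrDl addrC.
  by rewrite convDl.
have hu : asymp (k * r + 1) u (\sum_(1 <= l < r)
    'C(r, l)%:R * (momcst l 0 / (k * l - 1)%:R * momcst (r - l) 0) +
    (k * r)%:R * momcst (r - 1) (k - 1)).
  have h1 := asymp_mainterm r0' regr (fun s' (h : (s' < 0)%N) => match notF h with end).
  have h2 : asymp (k * r + 1) (conv (primR (excessmom r 0)) (invpow R 2)) 0.
    have := asymp_excessmom r0' regr (fun s' (h : (s' < 0)%N) => match notF h with end).
    rewrite addn0 => /(asymp_primR kr) /asymp_conv /(_ (@asymp_invpow R 2 isT)).
    rewrite subnK; last by lia.
    move=> h; apply: (asymp_lower _ (h _ _)) => //; lia.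
  rewrite addn0 in h1; rewrite mul0r addr0 addn0 in h1.
  rewrite -[X in asymp _ _ X]addr0; apply: asympD h2.
  rewrite [X in asymp _ _ X]addrC; apply: asympD; first exact: h1.
  rewrite conv_invpow1_sum; apply: asymp_sum => l.
  rewrite mem_index_iota => /andP[l1 lr] _; apply: asympZ.
  have := @asymp_split r 0 l; rewrite addn0; apply => //; first by lia.
    exact: regr.
  by move=> s' _; apply: regr; lia.
rewrite addn0; have := asymp_volterra _ hu uE.
have -> : (k * r + 1 - 2 = k * r - 1)%N by lia.
have -> : (k * r + 1 - 3 = k * r - 2)%N by lia.
by apply; lia.
Qed.

Lemma regular_all r s : regular r s.
Proof.
elim/ltn_ind: r s => r ihr; elim/ltn_ind => s ihs.
have regr r' s' : (r' < r)%N -> regular r' s' by move=> h; exact: ihr.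
case: (posnP s) => [s0|s0].
  case: (posnP r) => [r0|r0].
  2: by rewrite s0; have [] := regularP (asymp_pmom_zero r0 regr).
  rewrite r0 s0; apply: (proj1 (@regularP 0 0 1 _)).
  by rewrite muln0 pmom00; exact: asymp_invpow.
by have [] := regularP (asymp_pmom_pos (ltn_addl r s0) (introT orP (or_intror s0)) regr ihs).
Qed.

Lemma momcst_pos r s : (0 < r + s)%N -> (r == 0%N) || (0 < s)%N -> momcst r s =
  \sum_(1 <= l < r.+1) 'C(r, l)%:R * (momcst l 0 / (k * l - 1)%:R * momcst (r - l) s) +
  ((k * r)%:R * momcst (r - 1) (k + s - 1) + s%:R * momcst r (s - 1)).
Proof.
move=> rs rs'; apply: (proj2 (regularP (asymp_pmom_pos rs rs' _ _))) => *; exact: regular_all.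
Qed.

Lemma momcst_zero r : (0 < r)%N -> momcst r 0 =
  (\sum_(1 <= l < r) 'C(r, l)%:R * (momcst l 0 / (k * l - 1)%:R * momcst (r - l) 0) +
   (k * r)%:R * momcst (r - 1) (k - 1)) * (k * r - 1)%:R / (k * r - 2)%:R.
Proof.
move=> r0; apply: (proj2 (regularP (asymp_pmom_zero r0 _))) => *; exact: regular_all.
Qed.

Lemma momcst0 s : momcst 0 s = s`!%:R.
Proof.
elim: s => [|s ih].
  by apply: (proj2 (@regularP 0 0 1 _)); rewrite muln0 pmom00; exact: asymp_invpow.
rewrite momcst_pos// big_nil add0r muln0 mul0r add0r subn1 ih.
by rewrite -natrM factS.
Qed.

Lemma momcst_gt0 r s : 0 < momcst r s.
Proof.
elim/ltn_ind: r s => r ihr s; case: (posnP r) => [->|r0].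
  by rewrite momcst0 ltr0n fact_gt0.
have sum_ge0 m t : (m <= r.+1)%N -> (forall l, (l < m)%N -> 0 < momcst l 0) ->
    0 <= \sum_(1 <= l < m) 'C(r, l)%:R * (momcst l 0 / (k * l - 1)%:R * momcst (r - l) t).
  move=> mr h; rewrite big_nat_cond; apply: sumr_ge0 => l /andP[/andP[l1 lm] _].
  apply: mulr_ge0 => //; apply: mulr_ge0; last by apply/ltW/ihr; lia.
  by apply: divr_ge0 => //; exact/ltW/h.
have r10 t : 0 < (k * r)%:R * momcst (r - 1) t.
  by rewrite mulr_gt0 ?ihr ?ltr0n//; nia.
have zero : 0 < momcst r 0.
  rewrite momcst_zero// divr_gt0 ?ltr0n//; last by nia.
  rewrite mulr_gt0 ?ltr0n//; last by nia.
  by apply: ltr_wpDl => //; apply: sum_ge0 => // l lr; exact: ihr.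
elim: s => [//|s ihs]; rewrite momcst_pos ?addn_gt0 ?r0// ?orbT//.
apply: ltr_wpDl.
  apply: sum_ge0 => // l; rewrite ltnS leq_eqVlt => /predU1P[->//|lr]; exact: ihr.
by apply: ltr_wpDr; rewrite // subn1 mulr_ge0// ltW.
Qed.

(** After division by the total weight [invpow 1 n] these are the moments of the
    tree with n + 1 nodes, which explains the shift under the root. *)
Lemma pmom_growth r s :
  pmom r s n / (invpow R 1 n * Num.sqrt n.+1%:R ^+ (k * r + s)) @[n --> \oo] -->
  (Num.sqrt pi * momcst r s / GammaHalf R (k * r + s + 1)).
Proof.
set m := (k * r + s)%N.
have m0 : (0 < m + 1)%N by rewrite addn1.
have h := seq_cvgM (@regular_all r s) (invpow_growth (R := R) m0).
have hS : Num.sqrt n%:R / Num.sqrt n.+1%:R @[n --> \oo] --> (1 : R).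
  have h1 : (1 * n%:R + 0) / (1 * n%:R + 1) @[n --> \oo] --> (1 / 1 : R).
    by apply: cvg_affine_ratio => [|n]; rewrite ?oner_eq0// mul1r natr1 pnatr_eq0.
  have : Num.sqrt ((1 * n%:R + 0) / (1 * n%:R + 1)) @[n --> \oo] --> Num.sqrt (1 / 1 : R).
    by apply: (cvg_comp _ Num.sqrt h1); exact: sqrt_continuous.
  rewrite divr1 sqrtr1; apply: seq_cvg_eq; near=> n.
  by rewrite !mul1r addr0 natr1 sqrtrM// sqrtrV.
have := seq_cvgM h (cvg_pow (m := m) hS); rewrite expr1n mulr1 mulrA (mulrC (momcst r s)).
apply: seq_cvg_eq; near=> n.
have n0 : Num.sqrt n%:R != 0 :> R.
  by rewrite gt_eqF// sqrtr_gt0 ltr0n; near: n; exact: nbhs_infty_gt.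
have n1 : Num.sqrt n.+1%:R != 0 :> R by rewrite gt_eqF// sqrtr_gt0 ltr0n.
rewrite -/m /= expr_div_n [in _ ^+ (m + 1).-1]addn1/=; field.
by rewrite !invpow_neq0//= !expf_neq0.
Unshelve. all: by end_near. Qed.

End MomentAsymptotics.
(** * Plane trees and their histories *)

Section Trees.

Definition outdeg (t : plane_tree) : seq nat := map size t.

Fixpoint histories (n : nat) : seq plane_tree :=
  if n is n'.+1 then
    flatten [seq [seq attach t p | p <- free_places t] | t <- histories n']
  else [:: root_tree].

Lemma children_attach t u j v : (u < size t)%N -> children (attach t (u, j)) v =
  if v == u then take j (children t u) ++ size t :: drop j (children t u)
  else children t v.
Proof.
move=> ut; rewrite /attach /children nth_rcons size_set_nth (maxn_idPr ut) nth_set_nth /=.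
case: ltngtP => vt //; last by rewrite vt; case: eqP => [E|_]; [lia|rewrite nth_default].
by case: eqP => [E|_]; [lia|rewrite nth_default// ltnW].
Qed.

Lemma size_attach t u j : (u < size t)%N -> size (attach t (u, j)) = (size t).+1.
Proof. by move=> ut; rewrite size_rcons size_set_nth (maxn_idPr ut). Qed.

Lemma size_children_attach t u j v : (u < size t)%N ->
  size (children (attach t (u, j)) v) = ((v == u) + size (children t v))%N.
Proof.
move=> ut; rewrite children_attach//; case: eqP => [->|//].
by rewrite size_cat /= addnS -size_cat cat_take_drop.
Qed.

Lemma outdeg_attach t u j : (u < size t)%N ->
  outdeg (attach t (u, j)) = rcons (incr_nth (outdeg t) u) 0%N.
Proof.
move=> ut; have so : size (outdeg t) = size t by rewrite size_map.
apply: (@eq_from_nth _ 0%N) => [|v].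
  by rewrite size_map size_attach// size_rcons size_incr_nth so ut.
rewrite size_map size_attach// => vt.
rewrite (nth_map [::]) ?size_attach// -/(children _ v) size_children_attach//.
rewrite nth_rcons size_incr_nth so ut; move: vt; rewrite ltnS leq_eqVlt.
case/predU1P => [->|vt]; last by rewrite vt nth_incr_nth (nth_map [::])// eq_sym.
by rewrite ltnn eqxx gtn_eqF// /children nth_default.
Qed.

Lemma mem_free_places t p : (p \in free_places t) ->
  (p.1 < size t)%N.
Proof.
by move=> /allpairsPdep[v [j [+ _ ->]]]; rewrite mem_iota add0n.
Qed.

Lemma sum_free_places (V : nmodType) (f : seq nat -> V) t :
  \sum_(p <- free_places t) f (outdeg (attach t p)) = grow f (outdeg t).
Proof.
rewrite /free_places big_allpairs_dep /grow size_map.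
rewrite -[X in iota _ X]subn0 -/(index_iota 0 (size t)) big_mkord.
apply: eq_bigr => v _.
under eq_bigr do rewrite outdeg_attach//.
by rewrite big_const_seq count_predT size_iota (nth_map [::])// iter_addr_0.
Qed.

(** The last step of a history is the innermost application of [grow]. *)
Lemma sum_histories (V : nmodType) (f : seq nat -> V) n :
  \sum_(t <- histories n) f (outdeg t) = iter n (@grow V) f [:: 0%N].
Proof.
elim: n f => [|n ih] f; first by rewrite big_seq1.
rewrite /= big_flatten big_map -iterS iterSr -ih; apply: eq_bigr => t _.
by rewrite big_map sum_free_places.
Qed.

(** The first part makes the new label fresh, so that attaching it creates exactly
    one new edge. *)
Definition degree_ok (t : plane_tree) : Prop :=
  (forall u v, u \in children t v -> (u < size t)%N) /\
  (forall v, (v < size t)%N -> degree t v = ((0 < v) + size (children t v))%N).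

Lemma degree_sum t v : degree t v = (\sum_(x < size t) adjacent t v x)%N.
Proof.
rewrite /degree -sum1_card big_mkcond; apply: eq_bigr => x _.
by rewrite inE; case: (adjacent t v x).
Qed.

Lemma degree_ok_root : degree_ok root_tree.
Proof.
split=> [u v|[|v]//= _]; first by rewrite /children; case: v => [|[|v]].
by rewrite degree_sum big_ord1.
Qed.

Lemma degree_ok_attach t u j : (u < size t)%N -> degree_ok t ->
  degree_ok (attach t (u, j)).
Proof.
move=> ut [lt_ch deg].
have mem a b : (a \in children (attach t (u, j)) b) =
    (b == u) && (a == size t) || (a \in children t b).
  rewrite children_attach//; case: eqP => [->|//].
  by rewrite mem_cat inE orbCA -mem_cat cat_take_drop.
have adj a b : adjacent (attach t (u, j)) a b =
    [|| (a == u) && (b == size t), (b == u) && (a == size t) | adjacent t a b].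
  by rewrite /adjacent/= !mem -!orbA; congr (_ || _); rewrite orbCA.
have out v : (size t \in children t v) = false.
  by apply/negP => /lt_ch; rewrite ltnn.
have nil_t v : (v \in children t (size t)) = false.
  by rewrite /children nth_default.
have adjl x : adjacent t (size t) x = false by rewrite /adjacent/= nil_t out.
have adjr x : adjacent t x (size t) = false by rewrite /adjacent/= nil_t out.
have tu : (size t == u) = false by rewrite gtn_eqF.
split=> [a b|v].
  rewrite mem size_attach// => /orP[/andP[_ /eqP ->]//|/lt_ch/ltnW]; exact.
rewrite size_attach// ltnS leq_eqVlt degree_sum size_children_attach//.
rewrite size_attach// big_ord_recr /= => /predU1P[->|vt].
  rewrite adj adjl tu/= addn0 (leq_ltn_trans _ ut)// add0n.
  have -> : size (children t (size t)) = 0%N by rewrite /children nth_default.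
  rewrite (bigD1 (Ordinal ut))//= big1 => [|x xu]; rewrite adj adjl tu eqxx/=.
    by rewrite eqxx.
  by rewrite orbF andbT; move: xu; rewrite -val_eqE /= => /negbTE ->.
have vn : (v == size t) = false by rewrite ltn_eqF.
rewrite addnCA -deg// degree_sum addnC; congr (_ + _)%N.
  by rewrite adj adjr vn andbF eqxx andbT !orbF.
apply: eq_bigr => x _; rewrite adj vn andbF/= [nat_of_ord x == size t]ltn_eqF//.
by rewrite andbF.
Qed.

Lemma histories_ind (Q : nat -> plane_tree -> Prop) : Q 0 root_tree ->
  (forall n t u j, (u < size t)%N -> Q n t -> Q n.+1 (attach t (u, j))) ->
  forall n t, t \in histories n -> Q n t.
Proof.
move=> Q0 QS; elim=> [|n ih] t; first by rewrite inE => /eqP ->.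
move=> /flatten_mapP[t' /ih Qt' /mapP[[u j] /mem_free_places/= ut ->]].
exact: QS.
Qed.

Lemma histories_degree n t : t \in histories n -> degree_ok t.
Proof.
move: n t; apply: histories_ind => [|n t u j ut]; first exact: degree_ok_root.
exact: degree_ok_attach.
Qed.

Lemma histories_size n t : t \in histories n -> (0 < size t)%N.
Proof.
by move: n t; apply: histories_ind => // n t u j ut _; rewrite size_attach.
Qed.

Lemma size_free_places n t : t \in histories n -> size (free_places t) = (2 * n).+1.
Proof.
move=> tn; have -> : size (free_places t) = (size t + sumn (outdeg t))%N.
  rewrite /free_places size_allpairs_dep /outdeg sumnE !big_map.
  under eq_bigr do rewrite size_iota.
  rewrite -[X in iota _ X]subn0 -/(index_iota 0 (size t)) big_mkord.
  rewrite sumnE big_map (big_nth [::] predT) big_mkord; under eq_bigr do rewrite -add1n.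
  by rewrite big_split /= sum1_card card_ord.
move: n t tn; apply: histories_ind => // n t u j ut.
rewrite size_attach// outdeg_attach// sumn_rcons addn0.
have -> : sumn (incr_nth (outdeg t) u) = (sumn (outdeg t)).+1.
  have : (u < size (outdeg t))%N by rewrite size_map.
  elim: (outdeg t) u {ut} => [//|a l ih] [|u] /= ul; first by rewrite addSn.
  by rewrite ih// addnS.
by rewrite addSn addnS => ->; rewrite mulnS.
Qed.

Lemma zagreb_outdeg k n t : t \in histories n -> zagreb k t = zag k (outdeg t).
Proof.
move=> tn; have t0 := histories_size tn; have [_ deg] := histories_degree tn.
case: t t0 deg {tn} => [//|c t] _ deg.
rewrite /zagreb big_ord_recl deg// /zag /zagsub /= big_map; congr (_ + _)%N.
rewrite (big_nth [::]) big_mkord; apply: eq_bigr => i _.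
by rewrite deg ?lift0 ?ltnS.
Qed.

Lemma root_degree_outdeg n t : t \in histories n -> root_degree t = head 0%N (outdeg t).
Proof.
move=> tn; have t0 := histories_size tn; have [_ deg] := histories_degree tn.
by rewrite /root_degree deg//; case: t {tn t0 deg}.
Qed.

End Trees.
(** * The law of the random tree *)

Section DiscreteIntegral.
Context {R : realType} {d : measure_display} {T : measurableType d}.
Variables (P : probability T R) (K : countType) (Y : T -> K).
Hypothesis mY : forall y, measurable [set w | Y w = y].

Lemma discrete_measurable (A : set K) : measurable (Y @^-1` A).
Proof.
have -> : Y @^-1` A = \bigcup_y (if `[< A y >] then [set w | Y w = y] else set0).
  apply/seteqP; split => w /=.
    by move=> Aw; exists (Y w) => //; case: asboolP.
  by move=> [y _]; case: asboolP => // Ay /= ->.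
apply: countable_bigcupT_measurable => [|y]; first exact: countableP.
by case: asboolP.
Qed.

Lemma discrete_measurable_fun (f : K -> R) D : measurable D ->
  measurable_fun D (fun w => (f (Y w))%:E).
Proof.
move=> mD _ B mB; apply: measurableI => //.
by have := discrete_measurable [set y | B (f y)%:E].
Qed.

(** The values in [S] carry all the mass, so the complement is negligible. *)
Lemma discrete_integral (S : seq K) (f : K -> R) : uniq S ->
  (\sum_(y <- S) P [set w | Y w = y] = 1)%E -> (forall y, 0 <= f y) ->
  (\int[P]_w (f (Y w))%:E = \sum_(y <- S) (f y)%:E * P [set w | Y w = y])%E.
Proof.
move=> uS S1 f0; pose F y := [set w | Y w = y]; pose D := \big[setU/set0]_(y <- S) F y.
have mD : measurable D by apply: bigsetU_measurable => y _; exact: mY.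
have tF : trivIset [set` S] F by move=> y z _ _ [w [/= <- <-]].
have intD (g : K -> R) : (forall y, 0 <= g y) ->
    (\int[P]_(w in D) (g (Y w))%:E = \sum_(y <- S) (g y)%:E * P (F y))%E.
  move=> g0; rewrite ge0_integral_bigsetU//;
    [|exact: discrete_measurable_fun|by move=> w _; rewrite lee_fin].
  apply: eq_bigr => y _; rewrite -integral_cst//; last exact: mY.
  by apply: eq_integral => w; rewrite inE /F/= => ->.
have PD : (P D = 1)%E.
  have := intD (fun=> 1) (fun=> ler01); rewrite integral_cst// mul1e => ->.
  by rewrite -[RHS]S1; apply: eq_bigr => y _; rewrite mul1e.
rewrite -intD//.
have PDc : (P (~` D) = 0)%E by rewrite probability_setC// PD subee.
rewrite (ge0_negligible_integral (measurableC mD) measurableT _ _ PDc)//.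
- by rewrite setTD setCK.
- exact: discrete_measurable_fun.
- by move=> w _; rewrite lee_fin.
Qed.

End DiscreteIntegral.

Section RandomTree.
Context {R : realType} {d : measure_display} {Omega : measurableType d}.
Variables (P : probability Omega R) (N : nat).
Variables (T : nat -> Omega -> plane_tree) (U : nat -> Omega -> nat * nat).
Hypothesis T1 : forall w, T 1%N w = root_tree.
Hypothesis TS : forall i, (1 <= i < N)%N -> forall w,
  T i.+1 w = attach (T i w) (U i.+1 w).
Hypothesis TU : forall i, (1 <= i < N)%N -> forall (t : plane_tree) (p : nat * nat),
  measurable [set w | T i w = t /\ U i.+1 w = p] /\
  P [set w | T i w = t /\ U i.+1 w = p] =
    (P [set w | T i w = t] *
     (if p \in free_places t then (size (free_places t))%:R^-1 else 0)%:E)%E.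

Lemma size_histories n : size (histories n) = (\prod_(i < n) (2 * i).+1)%N.
Proof.
rewrite -sum1_size; elim: n => [|n ih]; first by rewrite big_seq1 big_ord0.
rewrite /= big_flatten big_map big_ord_recr/= -ih big_distrl/=.
rewrite big_seq [RHS]big_seq; apply: eq_bigr => t tn.
by rewrite sum1_size size_map mul1n (size_free_places tn).
Qed.

Definition joint i w := (T i w, U i.+1 w).

Lemma jointE i t p : [set w | joint i w = (t, p)] = [set w | T i w = t /\ U i.+1 w = p].
Proof. by apply/seteqP; split => w /=; rewrite /joint => -[-> ->]. Qed.

Lemma joint_measurable i : (1 <= i < N)%N ->
  forall y, measurable [set w | joint i w = y].
Proof. by move=> iN [t p]; rewrite jointE; have [] := TU iN t p. Qed.

Lemma tree_measurable i : (i < N)%N -> forall t, measurable [set w | T i.+1 w = t].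
Proof.
case: i => [|i] iN t.
  have -> : [set w | T 1 w = t] = if t == root_tree then setT else set0.
    by apply/seteqP; split => w /=; rewrite T1 eq_sym; case: eqP.
  by case: ifP.
have iN' : (1 <= i.+1 < N)%N by [].
have -> : [set w | T i.+2 w = t] = joint i.+1 @^-1` [set y | attach y.1 y.2 = t].
  by apply/seteqP; split => w /=; rewrite (TS iN').
exact: discrete_measurable (joint_measurable iN') _.
Qed.

Lemma histories_neq0 n : (size (histories n))%:R != 0 :> R.
Proof.
by rewrite pnatr_eq0 size_histories -lt0n prodn_gt0.
Qed.

Lemma sum_undup_count (V : nmodType) (K : eqType) (s : seq K) (f : K -> V) :
  \sum_(x <- undup s) f x *+ count_mem x s = \sum_(x <- s) f x.
Proof.
rewrite -(big_undup_iterop_count +%R s predT); exact: eq_bigr.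
Qed.

Lemma sum_eq_count (K : eqType) (s : seq K) (x : K) :
  \sum_(y <- s) (y == x)%:R = (count_mem x s)%:R :> R.
Proof.
elim: s => [|y s ih]; first by rewrite big_nil.
by rewrite big_cons /= natrD ih.
Qed.

Lemma uniq_free_places t : uniq (free_places t).
Proof.
apply: allpairs_uniq_dep; [exact: iota_uniq|by move=> v _; exact: iota_uniq|].
by move=> [v j] [v' j'] _ _ [/= -> ->].
Qed.

(** Applied to indicators, the induction hypothesis gives the law of the tree
    before the last step, hence the joint law of tree and place; their masses
    add up to 1. *)
Lemma tree_integral i (f : plane_tree -> R) : (i < N)%N -> (forall t, 0 <= f t) ->
  (\int[P]_w (f (T i.+1 w))%:E =
   (\sum_(t <- histories i) f t / (size (histories i))%:R)%:E)%E.
Proof.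
elim: i f => [|i ih] f iN f0.
  under eq_integral do rewrite T1.
  rewrite integral_cst// [X in (_ * X)%E](_ : _ = 1%E); last exact: probability_setT.
  by rewrite mule1 big_seq1 divr1.
have iN' : (1 <= i.+1 < N)%N by [].
have iN'' := ltnW iN.
have law t : (P [set w | T i.+1 w = t] =
    ((count_mem t (histories i))%:R / (size (histories i))%:R)%:E)%E.
  have := ih (fun t' => (t' == t)%:R) iN'' (fun=> ler0n _ _).
  rewrite -mulr_suml sum_eq_count => <-.
  rewrite -[in LHS](setIT [set w | _]) -integral_indic//; last exact: tree_measurable.
  apply: eq_integral => w _; rewrite indicE; congr ((nat_of_bool _)%:R%:E).
  by apply/idP/eqP; rewrite inE.
have WE : (size (histories i.+1))%:R = (size (histories i))%:R * (2 * i).+1%:R :> R.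
  by rewrite !size_histories big_ord_recr natrM.
pose S := [seq (t, p) | t <- undup (histories i), p <- free_places t].
have uS : uniq S.
  apply: allpairs_uniq_dep;
    [exact: undup_uniq|by move=> t _; exact: uniq_free_places|].
  by move=> [t p] [t' p'] _ _ [/= -> ->].
have sumS (g : plane_tree * (nat * nat) -> R) :
    (\sum_(y <- S) (g y)%:E * P [set w | joint i.+1 w = y] =
     (\sum_(t <- histories i) \sum_(p <- free_places t)
        g (t, p) / (size (histories i.+1))%:R)%:E)%E.
  rewrite big_allpairs_dep -[in RHS]sum_undup_count -sumEFin big_seq [in RHS]big_seq.
  apply: eq_bigr => t; rewrite mem_undup => tH.
  rewrite -sumrMnl -sumEFin big_seq [in RHS]big_seq; apply: eq_bigr => p pt.
  rewrite jointE; have [_ ->] := TU iN' t p; rewrite pt law -!EFinM; congr _%:E.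
  rewrite (size_free_places tH) WE invfM -mulr_natr; ring.
have E w : f (T i.+2 w) = (fun y => f (attach y.1 y.2)) (joint i.+1 w) by rewrite TS.
under eq_integral do rewrite E.
have histS (g : plane_tree -> R) : \sum_(t <- histories i) \sum_(p <- free_places t)
    g (attach t p) = \sum_(t <- histories i.+1) g t.
  by rewrite /= big_flatten big_map; apply: eq_bigr => t _; rewrite big_map.
rewrite (discrete_integral (S := S) (f := fun y => f (attach y.1 y.2))
  (joint_measurable iN'))//.
  by rewrite sumS (histS (fun t => f t / _)).
under eq_bigr do rewrite -[P _]mul1e.
rewrite (sumS (fun=> 1)) (histS (fun=> 1 / _)); congr _%:E.
by rewrite -mulr_suml big_const_seq count_predT iter_addr_0 divff// histories_neq0.
Qed.

End RandomTree.
(** * Asymptotic equivalence *)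

Section Final.
Variable R : realType.

Lemma expected_moment (k r s n : nat) d (Omega : measurableType d)
    (P : probability Omega R) (X : Omega -> plane_tree) :
  random_plane_recursive_tree P n.+1 X ->
  fine 'E_P[(fun w => (zagreb k (X w))%:R ^+ r * (root_degree (X w))%:R ^+ s)%R] =
  pmom R k r s n / invpow R 1 n.
Proof.
move=> [T [U [T1 TS TU ->]]]; rewrite unlock.
pose f (t : plane_tree) : R := (zagreb k t)%:R ^+ r * (root_degree t)%:R ^+ s.
have -> : (\int[P]_w ((zagreb k (T n.+1 w))%:R ^+ r * (root_degree (T n.+1 w))%:R ^+ s)%:E =
   \int[P]_w (f (T n.+1 w))%:E)%E by [].
rewrite (tree_integral T1 TS TU (ltnSn n)) => [|t]; last first.
  by rewrite mulr_ge0 ?exprn_ge0.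
rewrite /= -mulr_suml -[in LHS]sum1_size natr_sum -wsum1 /pmom /wsum.
have -> : \sum_(t <- histories n) f t =
    iter n (@grow R) (fun e => (zag k e)%:R ^+ r * (head 0%N e)%:R ^+ s) [:: 0%N].
  rewrite -sum_histories big_seq [RHS]big_seq; apply: eq_bigr => t tn.
  by rewrite /f (zagreb_outdeg k tn) (root_degree_outdeg tn).
have := sum_histories (fun=> 1 : R) n => ->.
set u := iter _ _ _ _; set v := iter _ _ _ _.
have c0 : (2 ^ n * n`!)%:R != 0 :> R.
  by rewrite pnatr_eq0 muln_eq0 expn_eq0/= -lt0n fact_gt0.
by rewrite invfM invrK mulrACA mulVf// mulr1.
Qed.

Lemma equiv_cvg (f h : nat -> R) (c : R) : c != 0 -> (forall n, h n.+1 != 0) ->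
  f n / h n @[n --> \oo] --> c -> f ~_\oo (fun n => c * h n).
Proof.
move=> c0 h0 fh; apply/eqaddoP => e e0.
have ec : 0 < e * `|c| by rewrite mulr_gt0// normr_gt0.
have /cvgrPdist_le/(_ _ ec)[N _ hN] := fh.
near=> n.
have n0 : (0 < n)%N by near: n; exact: nbhs_infty_gt.
have hn : h n != 0 by rewrite -(prednK n0).
have Nn : (N <= n)%N by near: n; exact: nbhs_infty_ge.
have := hN n Nn; rewrite /= -(ler_pM2r (_ : 0 < `|h n|)) ?normr_gt0//.
by rewrite -normrM mulrBl divfK// distrC normrM mulrA.
Unshelve. all: by end_near. Qed.

End Final.

Theorem proposition4p6 (R : realType) (k : nat) (hk : (3 <= k)%N) :
  exists g : nat -> nat -> R,
  [/\ forall s : nat, g 0%N s = s`!%:R * Num.sqrt pi / Gamma (s.+1%:R / 2),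
      forall r s : nat, (0 < r)%N -> (0 < s)%N ->
        g r s =
          1 / (2 * Num.sqrt pi * Gamma ((k * r + s + 1)%N%:R / 2)) *
            (\sum_(1 <= l < r.+1)
               'C(r, l)%:R * g l 0%N * g (r - l)%N s *
               Gamma (((k * l)%N%:R - 1) / 2) *
               Gamma ((k * (r - l) + s + 1)%N%:R / 2)) +
          Gamma ((k * r + s)%N%:R / 2) / Gamma ((k * r + s + 1)%N%:R / 2) *
            ((k * r)%N%:R * g (r - 1)%N (k + s - 1)%N +
             s%:R * g r (s - 1)%N),
      forall r : nat, (0 < r)%N ->
        g r 0%N =
          1 / (Num.sqrt pi * ((k * r)%N%:R - 2) *
               Gamma (((k * r)%N%:R - 1) / 2)) *
            (\sum_(1 <= l < r)
               'C(r, l)%:R * g l 0%N * g (r - l)%N 0%N *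
               Gamma (((k * l)%N%:R - 1) / 2) *
               Gamma ((k * (r - l) + 1)%N%:R / 2)) +
          (k * r)%N%:R * Gamma ((k * r)%N%:R / 2 - 1) /
            Gamma (((k * r)%N%:R - 1) / 2) * g (r - 1)%N (k - 1)%N &
      forall (d : nat -> measure_display)
        (Omega : forall n : nat, measurableType (d n))
        (P : forall n : nat, probability (Omega n) R)
        (X : forall n : nat, Omega n -> plane_tree),
        (forall n : nat, (1 <= n)%N ->
           random_plane_recursive_tree (P n) n (X n)) ->
        forall r s : nat,
          (fun n : nat =>
             fine 'E_(P n)[(fun w => (zagreb k (X n w))%:R ^+ r *
                                     (root_degree (X n w))%:R ^+ s)%R]%E : R)
          ~_\oo
          (fun n : nat => g r s * n%:R `^ ((k * r + s)%N%:R / 2))].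
Proof.
pose sp : R := Num.sqrt pi.
have sp0 : sp != 0 by rewrite gt_eqF// sqrtr_gt0 pi_gt0.
pose A := momcst R k; pose g r s := sp * A r s / GammaHalf R (k * r + s + 1).
have gE r s : g r s * GammaHalf R (k * r + s + 1) = sp * A r s.
  by rewrite divfK// GammaHalf_neq0// addn1.
have kN l : (0 < l)%N -> (k * l - 1)%:R != 0 :> R.
  by move=> l0; rewrite pnatr_eq0 -lt0n; nia.
(* Gamma((kl+1)/2) = (kl-1)/2 Gamma((kl-1)/2): the functional equation absorbs
   the factor kl - 1 of the recursion for A. *)
have Ghl l : (0 < l)%N -> 
    g l 0%N * GammaHalf R (k * l - 1) = 2 * sp * (A l 0%N / (k * l - 1)%:R).
  move=> l0; have kl : (0 < k * l - 1)%N by nia.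
  rewrite /g; have -> : (k * l + 0 + 1 = (k * l - 1).+2)%N by lia.
  rewrite GammaHalf_step//; field.
  by rewrite (GammaHalf_neq0 R kl) kN.
have nat1 l : (0 < l)%N -> (k * l)%:R - 1 = (k * l - 1)%:R :> R.
  by move=> l0; rewrite natrB//; nia.
have nat2 l : (0 < l)%N -> (k * l)%:R - 2 = (k * l - 2)%:R :> R.
  by move=> l0; rewrite natrB//; nia.
exists g; split.
- by move=> s; rewrite -GammaHalfE /g /A momcst0// muln0 add0n addn1 [sp * _]mulrC.
- move=> r s r0 s0; have rs : (0 < r + s)%N by rewrite addn_gt0 r0.
  rewrite -/sp -!GammaHalfE; set G := GammaHalf R (k * r + s + 1).
  have G0 : G != 0 by rewrite GammaHalf_neq0// addn1.
  apply: (mulIf G0); rewrite gE /A momcst_pos ?s0 ?orbT// -/A.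
  rewrite [RHS]mulrDl [LHS]mulrDr; congr (_ + _).
    rewrite [in RHS]mulr_sumr mulr_suml mulr_sumr big_nat_cond [RHS]big_nat_cond.
    apply: eq_bigr => l /andP[/andP[l0 lr] _].
    rewrite nat1// -!GammaHalfE.
    have -> : 'C(r, l)%:R * g l 0%N * g (r - l)%N s * GammaHalf R (k * l - 1) *
        GammaHalf R (k * (r - l) + s + 1) =
      'C(r, l)%:R * (g l 0%N * GammaHalf R (k * l - 1)) *
        (g (r - l)%N s * GammaHalf R (k * (r - l) + s + 1)) by ring.
    rewrite Ghl// gE; field.
    by rewrite G0 sp0 kN.
  have E1 : g (r - 1)%N (k + s - 1)%N * GammaHalf R (k * r + s) =
      sp * A (r - 1)%N (k + s - 1)%N.
    by rewrite -gE; congr (_ * GammaHalf R _); nia.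
  have E2 : g r (s - 1)%N * GammaHalf R (k * r + s) = sp * A r (s - 1)%N.
    by rewrite -gE; congr (_ * GammaHalf R _); lia.
  have -> : GammaHalf R (k * r + s) / G * ((k * r)%:R * g (r - 1)%N (k + s - 1)%N +
      s%:R * g r (s - 1)%N) * G =
     (k * r)%:R * (g (r - 1)%N (k + s - 1)%N * GammaHalf R (k * r + s)) +
      s%:R * (g r (s - 1)%N * GammaHalf R (k * r + s)) by field.
  by rewrite E1 E2; ring.
- move=> r r0; rewrite -/sp nat1// nat2//.
  have -> : (k * r)%:R / 2 - 1 = (k * r - 2)%:R / 2 :> R by rewrite -nat2//; field.
  rewrite -!GammaHalfE; have kr : (3 <= k * r)%N by nia.
  have G0 : GammaHalf R (k * r - 1) != 0 by rewrite GammaHalf_neq0//; lia.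
  have k1 := kN _ r0.
  have k2 : (k * r - 2)%:R != 0 :> R by rewrite pnatr_eq0 -lt0n; lia.
  apply: (mulIf G0); rewrite Ghl// /A momcst_zero// -/A.
  have E0 (x y : R) : 2 * sp * ((x + y) * (k * r - 1)%:R / (k * r - 2)%:R / (k * r - 1)%:R) =
      2 * sp / (k * r - 2)%:R * x + 2 * sp / (k * r - 2)%:R * y.
    by field; rewrite k1 k2.
  rewrite E0 [RHS]mulrDl; congr (_ + _).
    rewrite mulr_sumr [in RHS]mulr_sumr mulr_suml big_nat_cond [RHS]big_nat_cond.
    apply: eq_bigr => l /andP[/andP[l0 lr] _].
    rewrite nat1// -!GammaHalfE.
    have -> : 'C(r, l)%:R * g l 0%N * g (r - l)%N 0%N * GammaHalf R (k * l - 1) *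
        GammaHalf R (k * (r - l) + 1) =
      'C(r, l)%:R * (g l 0%N * GammaHalf R (k * l - 1)) *
        (g (r - l)%N 0%N * GammaHalf R (k * (r - l) + 0 + 1)) by rewrite addn0; ring.
    rewrite Ghl// gE; field.
    by rewrite G0 sp0 k2 kN.
  have E1 : g (r - 1)%N (k - 1)%N * GammaHalf R (k * r - 2) =
      2 * sp * A (r - 1)%N (k - 1)%N / (k * r - 2)%:R.
    have := gE (r - 1)%N (k - 1)%N.
    have -> : (k * (r - 1) + (k - 1) + 1 = (k * r - 2).+2)%N by nia.
    have k20 : (0 < k * r - 2)%N by lia.
    by rewrite (GammaHalf_step R k20) -[2 * sp * _]mulrA => <-; field.
  have -> : (k * r)%:R * GammaHalf R (k * r - 2) / GammaHalf R (k * r - 1) *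
      g (r - 1)%N (k - 1)%N * GammaHalf R (k * r - 1) =
    (k * r)%:R * (g (r - 1)%N (k - 1)%N * GammaHalf R (k * r - 2)) by field.
  by rewrite E1; field.
- move=> d Omega P X hX r s.
  have g0 : g r s != 0.
    by rewrite gt_eqF// divr_gt0 ?GammaHalf_gt0 ?addn1// mulr_gt0 ?momcst_gt0// sqrtr_gt0 pi_gt0.
  have h0 n : n.+1%:R `^ ((k * r + s)%:R / 2) != 0 :> R by rewrite gt_eqF// powR_gt0.
  apply: (equiv_cvg (h := fun n => n%:R `^ ((k * r + s)%:R / 2)) g0 h0).
  apply: seq_cvgS; move: (@pmom_growth R k hk r s); apply: seq_cvg_eq; near=> n.
  rewrite (expected_moment k r s (hX n.+1 isT)).
  have -> : n.+1%:R `^ ((k * r + s)%:R / 2) = Num.sqrt n.+1%:R ^+ (k * r + s) :> R.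
    by rewrite mulrC powRrM powR12_sqrt// powR_mulrn.
  by rewrite invfM mulrA.
Unshelve. all: by end_near. Qed.
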